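(* Let $\Omega$ be a nonempty open subset of $\mathbb{R}^N$, $p\in[1,+\infty)$ and $\omega$ an admissible weight function in $\Omega$. For a compact set $K\subset\Omega$ consider the conditions $$(\mathrm{A}_p)\quad\int_K\int_\Omega\omega(x,y)^p\,\mathrm{d}y\,\mathrm{d}x<+\infty,\qquad\qquad(\mathrm{A}_\infty)\quad\sup_{(x,y)\in K\times\Omega}\omega(x,y)<+\infty.$$ Then: (1) $W^{1,p}_\omega(\Omega)\cap\mathcal{C}^\infty_c(\Omega)\neq\{0\}$ if and only if there exists a compact set $K\subset\Omega$ with nonempty interior such that $(\mathrm{A}_p)$ holds. (2) $W^{1,\infty}_\omega(\Omega)\cap\mathcal{C}^\infty_c(\Omega)\neq\{0\}$ if and only if there exists a compact set $K\subset\Omega$ with nonempty interior such that $(\mathrm{A}_\infty)$ holds. (3) $\mathcal{C}^\infty_c(\Omega)\subset W^{1,p}_\omega(\Omega)$ if and only if $(\mathrm{A}_p)$ holds for every compact set $K\subset\Omega$. (4) $\mathcal{C}^\infty_c(\Omega)\subset W^{1,\infty}_\omega(\Omega)$ if and only if $(\mathrm{A}_\infty)$ holds for every compact set $K\subset\Omega$. (5) If $p=1$, statements (1) and (3) also hold with $W^{1,1}_\omega(\Omega)$ replaced by $\mathrm{NLBV}_\omega(\Omega)$.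
   Context: An admissible weight function in $\Omega$ is a function $\omega:\Omega\times\Omega\to[0,+\infty)$ belonging to $\mathcal{C}^1(\Omega\times\Omega)$ with $\omega(x,y)=\omega(y,x)$ for all $(x,y)$. For $\psi\in\mathcal{C}^1_c(\Omega\times\Omega)$ and $i=1,\dots,N$ put $$\partial^*_{\omega,i}(\psi)(x):=\int_\Omega\frac{\partial}{\partial x_i}\left[\omega(x,y)(\psi(y,x)-\psi(x,y))\right]\mathrm{d}y,\quad x\in\Omega.$$ A function $u\in L^1_{\mathrm{loc}}(\Omega)$ has weak $i$-th nonlocal partial derivative $\partial_{\omega,i}u\in L^1_{\mathrm{loc}}(\Omega\times\Omega)$ if $$\int_\Omega u(x)\,\partial^*_{\omega,i}(\psi)(x)\,\mathrm{d}x=-\int_{\Omega\times\Omega}\partial_{\omega,i}u(x,y)\,\psi(x,y)\,\mathrm{d}x\,\mathrm{d}y\quad\text{for all }\psi\in\mathcal{C}^1_c(\Omega\times\Omega);$$ it is unique a.e. Put $\nabla_\omega u:=(\partial_{\omega,1}u,\dots,\partial_{\omega,N}u)$. For $p\in[1,+\infty]$, $W^{1,p}_\omega(\Omega):=\{u\in L^p(\Omega):\nabla_\omega u\in L^p(\Omega\times\Omega;\mathbb{R}^N)\}$. For $\phi=(\phi_1,\dots,\phi_N)\in\mathcal{C}^1_c(\Omega\times\Omega;\mathbb{R}^N)$, $\mathrm{div}_\omega(\phi):=\sum_{i=1}^N\partial^*_{\omega,i}(\phi_i)$. For $u\in L^1(\Omega)$, $\mathrm{NLTV}_\omega(u)$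 is the supremum of $\int_\Omega u\,\mathrm{div}_\omega(\phi)\,\mathrm{d}x$ over all $\phi\in\mathcal{C}^1_c(\Omega\times\Omega;\mathbb{R}^N)$ whose pointwise Euclidean norm is at most $1$ everywhere, and $\mathrm{NLBV}_\omega(\Omega):=\{u\in L^1(\Omega):\mathrm{NLTV}_\omega(u)<+\infty\}$. *)

(* Defs.v *)
From HB Require Import structures.
From mathcomp Require Import all_boot all_order all_algebra.
From mathcomp Require Import all_classical all_reals all_analysis.

Set Implicit Arguments.
Unset Strict Implicit.
Unset Printing Implicit Defensive.

Import Order.TTheory GRing.Theory Num.Theory.
Import numFieldNormedType.Exports.

Local Open Scope classical_set_scope.
Local Open Scope ring_scope.

Definition measure_rV_display : measure_display -> measure_display.
Proof. exact. Qed.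

Section measurable_rV.
Context {d} {T : measurableType d} (n : nat).

Let coors : 'I_n -> 'rV[T]_n -> T := fun i v => v ord0 i.

Let rV_set0 : g_sigma_preimage coors set0.
Proof. exact: sigma_algebra0. Qed.

Let rV_setC A : g_sigma_preimage coors A -> g_sigma_preimage coors (~` A).
Proof. exact: sigma_algebraC. Qed.

Let rV_bigcup (F : (set 'rV[T]_n)^nat) :
  (forall i, g_sigma_preimage coors (F i)) ->
  g_sigma_preimage coors (\bigcup_i (F i)).
Proof. exact: sigma_algebra_bigcup. Qed.

(* The product sigma-algebra, generated by the coordinates; over the reals it
   is the Borel sigma-algebra. *)
HB.instance Definition _ := @isMeasurable.Build (measure_rV_display d)
  'rV[T]_n (g_sigma_preimage coors) rV_set0 rV_setC rV_bigcup.

End measurable_rV.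

Lemma measurable_coord d (T : measurableType d) n (i : 'I_n) :
  measurable_fun [set: 'rV[T]_n] (fun v : 'rV[T]_n => v ord0 i).
Proof.
move=> _ Y mY; rewrite setTI; apply: sub_sigma_algebra => /=.
rewrite -bigcup_seq/=; exists i => /=; first by rewrite mem_index_enum.
by exists Y => //; rewrite setTI.
Qed.

Lemma measurable_fun_coordP d1 d2 (T1 : measurableType d1)
    (T2 : measurableType d2) n (f : T1 -> 'rV[T2]_n) :
  (forall i, measurable_fun [set: T1] (fun x => f x ord0 i)) ->
  measurable_fun [set: T1] f.
Proof.
move=> mf; apply: (@iffLR _ _ (iff_refl _)).
have : g_sigma_preimage (fun i x => f x ord0 i) `<=` @measurable _ T1.
  apply: smallest_sub; first exact: sigma_algebra_measurable.
  rewrite -bigcup_seq/= => A [i _ [B mB <-]]; exact: mf.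
rewrite (@g_sigma_preimage_comp _ _ n _ (fun i (v : 'rV[T2]_n) => v ord0 i) _ f).
by move=> sub _ A mA; apply: sub; exists A.
Qed.

Section lebesgue_measure_rV.
Context {R : realType}.

Definition rV_cons n (z : measurableTypeR R * 'rV[R]_n) : 'rV[R]_n.+1 :=
  \row_i oapp (z.2 ord0) z.1 (unlift ord0 i).

Fixpoint lebesgue_rV n : set 'rV[R]_n -> \bar R :=
  match n with
  | 0 => \d_(0 : 'rV[R]_0)
  | m.+1 => pushforward (lebesgue_measure \x @lebesgue_rV m)%E (@rV_cons m)
  end.

Let rV_cons0 n (z : measurableTypeR R * 'rV[R]_n) : rV_cons z ord0 ord0 = z.1.
Proof. by rewrite mxE unlift_none. Qed.

Let rV_consS n (z : measurableTypeR R * 'rV[R]_n) i :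
  rV_cons z ord0 (lift ord0 i) = z.2 ord0 i.
Proof. by rewrite mxE liftK. Qed.

Lemma measurable_rV_cons n : measurable_fun [set: measurableTypeR R * 'rV[R]_n] (@rV_cons n).
Proof.
apply: measurable_fun_coordP => i; case: (unliftP ord0 i) => [j ->|->].
  under eq_fun do rewrite rV_consS.
  apply: (@measurableT_comp _ _ _ _ _ _ (fun v : 'rV[R]_n => v ord0 j)) => //.
  exact: measurable_coord.
by rewrite (_ : (fun _ => _) = fst)//; apply/funext => z; exact: rV_cons0.
Qed.

Let rV_uncons n (v : 'rV[R]_n.+1) : measurableTypeR R * 'rV[R]_n :=
  (v ord0 ord0, \row_i v ord0 (lift ord0 i)).

Let measurable_rV_uncons n : measurable_fun [set: 'rV[R]_n.+1] (@rV_uncons n).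
Proof.
apply: measurable_fun_pair; first exact: measurable_coord.
apply: measurable_fun_coordP => i /=; under eq_fun do rewrite mxE.
exact: measurable_coord.
Qed.

Let rV_consK n : cancel (@rV_cons n) (@rV_uncons n).
Proof.
move=> z; rewrite /rV_uncons rV_cons0 [RHS]surjective_pairing; congr pair.
by apply/rowP => i; rewrite mxE rV_consS.
Qed.

Let rV_unconsK n : cancel (@rV_uncons n) (@rV_cons n).
Proof.
move=> v; apply/rowP => i; case: (unliftP ord0 i) => [j ->|->].
  by rewrite rV_consS mxE.
by rewrite rV_cons0.
Qed.

Let pushforward_rV_cons n (m : {sigma_finite_measure set 'rV[R]_n -> \bar R}) :
  exists m' : {sigma_finite_measure set 'rV[R]_n.+1 -> \bar R},
    pushforward (lebesgue_measure \x m)%E (@rV_cons n) = m' :> (set _ -> \bar R).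
Proof.
pose mu : {measure set _ -> \bar R} := (lebesgue_measure \x m)%E.
pose nu := pushforward mu (@rV_cons n).
have mc A : measurable A -> measurable (@rV_cons n @^-1` A).
  by move=> mA; rewrite -[X in measurable X]setTI; exact: measurable_rV_cons.
have nu0 : nu set0 = 0%E by rewrite /nu /pushforward preimage_set0 measure0.
have nu_ge0 A : (0 <= nu A)%E by exact: (measure_ge0 mu).
have nu_sigma : semi_sigma_additive nu.
  move=> F mF tF mUF; rewrite /nu /pushforward preimage_bigcup.
  apply: measure_semi_sigma_additive => [k||]; first exact: mc.
  - apply/trivIsetP => /= i j _ _ ij; rewrite -preimage_setI.
    by move/trivIsetP : tF => /(_ _ _ _ _ ij) ->//; rewrite preimage_set0.
  - by rewrite -preimage_bigcup; exact: mc.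
have nu_fin : sigma_finite setT nu.
  have /sigma_finiteP[F [TF ndF Foo]] := sigma_finiteT (@lebesgue_measure R).
  have /sigma_finiteP[G [TG ndG Goo]] := sigma_finiteT m.
  exists (fun k => @rV_uncons n @^-1` (F k `*` G k)).
    rewrite -preimage_bigcup (_ : \bigcup_k _ = setT) ?preimage_setT//.
    apply/seteqP; split => // -[x y] _.
    have [i _ Fix] : (\bigcup_i F i) x by rewrite -TF.
    have [j _ Gjy] : (\bigcup_i G i) y by rewrite -TG.
    exists (maxn i j) => //; split => /=.
      by move: x Fix; exact/subsetPset/ndF/leq_maxl.
    by move: y Gjy; exact/subsetPset/ndG/leq_maxr.
  move=> k; have [mF Fk] := Foo k; have [mG Gk] := Goo k; split.
    rewrite -[X in measurable X]setTI; apply: measurable_rV_uncons => //.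
    exact: measurableX.
  rewrite /nu /pushforward (_ : _ @^-1` _ = F k `*` G k).
    by rewrite /mu/= product_measure1E// lte_mul_pinfty// ge0_fin_numE.
  by apply/seteqP; split => z; rewrite /preimage /mkset rV_consK.
rewrite -/mu -/nu; move: nu0 nu_ge0 nu_sigma nu_fin; move: nu => nu nu0 nu_ge0 nu_sigma nu_fin.
pose nuM := isMeasure.Build _ _ _ nu nu0 nu_ge0 nu_sigma.
pose nuS : Measure.type _ _ := HB.pack nu nuM.
pose nuF := @Measure_isSigmaFinite.Build _ _ _ nuS nu_fin.
pose nuSF : SigmaFiniteMeasure.type _ _ := HB.pack nu nuM nuF.
by exists nuSF.
Qed.

Let lebesgue_rV_ex n : exists m : {sigma_finite_measure set 'rV[R]_n -> \bar R},
  @lebesgue_rV n = m :> (set _ -> \bar R).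
Proof.
elim: n => [|n [m mE]]; first by exists (\d_(0 : 'rV[R]_0)).
by have [m' m'E] := pushforward_rV_cons m; exists m'; rewrite -m'E /= mE.
Qed.

Let lebesgue_rV0 n : @lebesgue_rV n set0 = 0%E.
Proof. by have [m ->] := lebesgue_rV_ex n; exact: measure0. Qed.

Let lebesgue_rV_ge0 n A : (0 <= @lebesgue_rV n A)%E.
Proof. by have [m ->] := lebesgue_rV_ex n; exact: measure_ge0. Qed.

Let lebesgue_rV_sigma_additive n : semi_sigma_additive (@lebesgue_rV n).
Proof.
by have [m ->] := lebesgue_rV_ex n; exact: measure_semi_sigma_additive.
Qed.

HB.instance Definition _ n := isMeasure.Build _ _ _ (@lebesgue_rV n)
  (lebesgue_rV0 n) (@lebesgue_rV_ge0 n) (@lebesgue_rV_sigma_additive n).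

Let lebesgue_rV_sigma_finite n : sigma_finite setT (@lebesgue_rV n).
Proof. by have [m ->] := lebesgue_rV_ex n; exact: sigma_finiteT. Qed.

HB.instance Definition _ n := Measure_isSigmaFinite.Build _ _ _
  (@lebesgue_rV n) (@lebesgue_rV_sigma_finite n).

Lemma lebesgue_rV_box n (A : 'I_n -> set R) : (forall i, measurable (A i)) ->
  lebesgue_rV [set v : 'rV[R]_n | forall i, A i (v ord0 i)] =
  (\prod_(i < n) lebesgue_measure (A i))%E.
Proof.
elim: n A => [|n IHn] A mA /=.
  by rewrite big_ord0 diracE mem_set// => -[].
rewrite big_ord_recl -IHn//.
set B := [set v : 'rV[R]_n | _].
have mB : measurable B.
  rewrite (_ : B = \big[setI/setT]_(i < n)
      ((fun v : 'rV[R]_n => v ord0 i) @^-1` A (lift ord0 i))).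
    apply: bigsetI_measurable => i _; rewrite -[X in measurable X]setTI.
    exact: (measurable_coord _ measurableT (mA _)).
  apply/seteqP; split => v /=; rewrite -bigcap_seq /=.
    by move=> h i _; exact: h.
  by move=> h i; have := h i; apply; rewrite /= mem_index_enum.
have mA0 := mA ord0.
rewrite -product_measure1E// (_ : A ord0 `*` B =
  @rV_cons n @^-1` [set v : 'rV[R]_n.+1 | forall i, A i (v ord0 i)])//.
apply/seteqP; split => [z [/= A0 AS] i|z /= Az].
  by case: (unliftP ord0 i) => [j ->|->]; rewrite ?rV_consS ?rV_cons0.
by split => [|i]; [rewrite /= -rV_cons0|rewrite -rV_consS].
Qed.

End lebesgue_measure_rV.

Section function_spaces.
Context {R : realType}.

(* C^k regularity on an open set U: in finite dimension the differential of f
   is of class C^k iff all the directional derivatives of f are. *)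
Fixpoint is_Ck (V : normedModType R) (k : nat) (U : set V) (f : V -> R) : Prop :=
  match k with
  | 0 => forall x, U x -> {for x, continuous f}
  | j.+1 => (forall x, U x -> differentiable f x) /\
            (forall v, is_Ck j U (fun x => 'D_v f x))
  end.

Definition compactly_supported (V : normedModType R) (U : set V) (f : V -> R) :=
  compact (closure [set x | f x != 0]) /\ closure [set x | f x != 0] `<=` U.

(* The support is taken in V, so that an element of C^k_c(U) is identified with
   its extension by zero. *)
Definition Ck_c (V : normedModType R) (k : nat) (U : set V) : set (V -> R) :=
  [set f | is_Ck k U f /\ compactly_supported U f].

Definition Cinfty_c (V : normedModType R) (U : set V) : set (V -> R) :=
  [set f | (forall k, is_Ck k U f) /\ compactly_supported U f].

(* Honest functions on the whole type rather than classes of functions on D;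
   the values outside D are irrelevant. *)
Definition Lp d (T : measurableType d) (mu : {measure set T -> \bar R})
    (D : set T) (p : \bar R) : set (T -> R) :=
  [set f | measurable_fun D f /\ finite_norm mu p (f \_ D)].

End function_spaces.

Section nonlocal.
Context {R : realType} {N : nat}.
Local Notation V := 'rV[R]_N.
Local Notation leb := (@lebesgue_rV R N).
Local Notation leb2 := (leb \x leb)%E.

Definition L1loc (Omega : set V) : set (V -> R) :=
  [set u | measurable_fun Omega u /\
    forall K, compact K -> K `<=` Omega -> leb.-integrable K (EFin \o u)].

Definition L1loc2 (Omega : set V) : set (V * V -> R) :=
  [set g | measurable_fun (Omega `*` Omega) g /\
    forall K, compact K -> K `<=` Omega `*` Omega ->
      leb2.-integrable K (EFin \o g)].

Definition euclid (a : 'I_N -> R) : R := Num.sqrt (\sum_(i < N) a i ^+ 2).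

Definition admissible (Omega : set V) (w : V * V -> R) : Prop :=
  [/\ is_Ck 1 (Omega `*` Omega) w,
      (forall x y, Omega x -> Omega y -> 0 <= w (x, y)) &
      (forall x y, Omega x -> Omega y -> w (x, y) = w (y, x))].

Variables (Omega : set V) (w : V * V -> R).

Definition nl_partial_adj (i : 'I_N) (psi : V * V -> R) (x : V) : R :=
  \int[leb]_(y in Omega)
    'D_(delta_mx ord0 i : V)
      (fun x' => w (x', y) * (psi (y, x') - psi (x', y))) x.

Definition is_weak_nl_partial (i : 'I_N) (u : V -> R) (g : V * V -> R) : Prop :=
  [/\ L1loc Omega u, L1loc2 Omega g &
    forall psi, Ck_c 1 (Omega `*` Omega) psi ->
      \int[leb]_(x in Omega) (u x * nl_partial_adj i psi x) =
      - \int[leb2]_(z in Omega `*` Omega) (g z * psi z)].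

Definition W1 (p : \bar R) : set (V -> R) :=
  [set u | Lp leb Omega p u /\
    exists g : 'I_N -> V * V -> R,
      (forall i, is_weak_nl_partial i u (g i)) /\
      Lp leb2 (Omega `*` Omega) p (fun z => euclid (fun i => g i z))].

Definition nl_div (phi : 'I_N -> V * V -> R) (x : V) : R :=
  \sum_(i < N) nl_partial_adj i (phi i) x.

Definition NLTV (u : V -> R) : \bar R :=
  ereal_sup [set (\int[leb]_(x in Omega) (u x * nl_div phi x)%:E)%E |
    phi in [set phi | (forall i, Ck_c 1 (Omega `*` Omega) (phi i)) /\
                      (forall z, euclid (fun i => phi i z) <= 1)]].

Definition NLBV : set (V -> R) :=
  [set u | Lp leb Omega 1%:E u /\ (NLTV u < +oo)%E].

Definition cond_A (p : R) (K : set V) : Prop :=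
  (\int[leb]_(x in K) \int[leb]_(y in Omega) ((w (x, y)) `^ p)%:E < +oo)%E.

Definition cond_Aoo (K : set V) : Prop :=
  (ereal_sup [set (w z)%:E | z in K `*` Omega] < +oo)%E.

End nonlocal.

(* Main.v *)
Require Import Defs.
From HB Require Import structures.
From mathcomp Require Import all_boot all_order all_algebra.
From mathcomp Require Import all_classical all_reals all_analysis.
From mathcomp Require Import ess_sup_inf measurable_realfun ring lra.

Set Implicit Arguments.
Unset Strict Implicit.
Unset Printing Implicit Defensive.

Import Order.TTheory GRing.Theory Num.Theory.
Import numFieldNormedType.Exports.

Local Open Scope classical_set_scope.
Local Open Scope ring_scope.

(** For a function [u] of class C^1 with compact support the nonlocal gradient
    is the explicit field [w (x, y) * (Du y - Du x)]: integrate by parts in the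
    first variable, then exchange the two variables and use the symmetry of the
    weight ([nl_grad], [integral_nl_partial_adj]). By the fundamental lemma of
    the calculus of variations ([ae_zero_of_test_functions]) every weak
    nonlocal gradient agrees with it almost everywhere
    ([weak_nl_partial_unique]). The theorem is thus about the size of this
    field.

    If the weight satisfies the condition on a compact set [K] that contains
    the support of [u], the field is bounded by a multiple of the weight, and
    it vanishes unless one of the two points lies in [K]; by symmetry both cases
    are controlled by the weight on [K * Omega] ([W1_of_cond_A],
    [W1_of_cond_Aoo], [NLBV_of_cond_A]).

    Conversely, let a partial derivative of [u] be nonzero at [x0], and let [B]
    be a small closed ball around [x0]. For [x] in [B] and [y] outside the
    support of [u] there is no cancellation in [Du y - Du x], so the weight is
    bounded by a multiple of the field; for [y] in the support, [(x, y)] ranges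
    over a compact set, on which the weight is bounded. Hence the condition
    holds on [B] ([cond_A_of_W1], [cond_Aoo_of_W1]). For the functions of
    bounded variation the field is only known through its integrals against
    test fields, and increasing cutoff functions recover the integral of the
    weight by monotone convergence ([cond_A_of_NLBV]).

    It remains to pass from local to global ([nontrivial_iff],
    [inclusion_iff]). A nonzero test function has a nonzero partial derivative
    somewhere, which gives one ball; if all test functions are admitted, every
    point of [Omega] is the centre of such a ball, and finitely many of them
    cover a given compact set. *)

(** * Balls, open sets and the product sigma-algebra *)

Section euclidean_topology.
Context {R : realType} {n : nat}.
Local Notation V := 'rV[R]_n.

Lemma rV_ballP (a : V) r x :
  ball a r x <-> 0 < r /\ forall i, `|a ord0 i - x ord0 i| < r.
Proof.
split=> [[r0 h]|[r0 h]]; split => // i; first by have := h ord0 i.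
by move=> j; rewrite ord1; exact: h.
Qed.

Lemma measurable_ball_rV (a : V) r : measurable (ball a r).
Proof.
have [r0|r0] := ltP 0 r; last first.
  rewrite (_ : ball a r = set0)// -subset0 => x /rV_ballP[].
  by rewrite ltNge r0.
rewrite (_ : ball a r = \big[setI/setT]_(i < n)
    ((fun v : V => v ord0 i) @^-1` ball (a ord0 i) r)).
  apply: bigsetI_measurable => i _; rewrite -[X in measurable X]setTI.
  by apply: (measurable_coord _ measurableT); exact: measurable_ball.
apply/seteqP; split => x /=; rewrite -bigcap_seq /=.
  by move=> /rV_ballP[_ h] i _; exact: h.
by move=> h; apply/rV_ballP; split => // i; apply: h; rewrite /= mem_index_enum.
Qed.

Lemma measurable_ball_rV2 (a : V * V) r : measurable (ball a r).
Proof.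
rewrite (_ : ball a r = ball a.1 r `*` ball a.2 r)//.
by apply: measurableX; exact: measurable_ball_rV.
Qed.

Lemma rational_rV_dense (x : V) e : 0 < e ->
  exists q : 'rV[rat]_n, ball (map_mx ratr q : V) e x.
Proof.
move=> e0.
have h i : exists q : rat, `|ratr q - x ord0 i| < e.
  have [|q] := @rat_in_itvoo R (x ord0 i - e) (x ord0 i + e).
    by rewrite ltrBlDr -addrA ltrDl addr_gt0.
  rewrite in_itv/= => /andP[q1 q2]; exists q; rewrite ltr_norml.
  by rewrite ltrBrDr ltrBlDr addrC q1/= addrC.
have [q hq] := choice h.
exists (\row_i q i); apply/rV_ballP; split => // i; rewrite !mxE; exact: hq.
Qed.

(** The centres and radii are rational, whence the countability. Doubling the
    radius leaves room for the closed balls, which serve as compact sets inside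
    [U]. *)
Lemma open_bigcup_ball (U : set (V * V)) : open U ->
  exists (a : nat -> V * V) (r : nat -> R),
    (forall k, ball (a k) (r k *+ 2) `<=` U) /\ U = \bigcup_k ball (a k) (r k).
Proof.
move=> oU.
pose c (t : ('rV[rat]_n * 'rV[rat]_n) * nat) : V * V :=
  (map_mx ratr t.1.1, map_mx ratr t.1.2).
pose s (t : ('rV[rat]_n * 'rV[rat]_n) * nat) : R := t.2.+1%:R^-1.
pose dat k := if unpickle k is Some t then
  if `[< ball (c t) (s t *+ 2) `<=` U >] then (c t, s t) else ((0, 0), 0)
  else ((0, 0), 0).
have ball0 (z : V * V) : ball z 0 = set0.
  by rewrite -subset0 => y [/rV_ballP[]]; rewrite ltxx.
exists (fun k => (dat k).1), (fun k => (dat k).2).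
have dU k : ball (dat k).1 ((dat k).2 *+ 2) `<=` U.
  rewrite /dat; case: unpickle => [t|]; last by rewrite mul0rn ball0.
  by case: asboolP => //= _; rewrite mul0rn ball0.
split => //; apply/seteqP; split => [z Uz|z [k _ zk]]; last first.
  apply: (dU k); apply: le_ball zk; rewrite mulr2n lerDl.
  by rewrite /dat; case: unpickle => // t; case: asboolP => //= _; rewrite /s.
have /nbhs_ballP[e/= e0 eU] : nbhs z U by exact: open_nbhs_nbhs.
(* The ball of radius [2 / m.+1] whose centre is within [1 / m.+1] of [z] must lie
   within [e] of [z]. *)
pose m := Num.truncn (3 / e); have m3 : 3 * m.+1%:R^-1 < e.
  by rewrite ltr_pdivrMr// mulrC -ltr_pdivrMr// Num.Theory.truncnS_gt.
have [q1 z1] := @rational_rV_dense z.1 m.+1%:R^-1 ltac:(by rewrite invr_gt0).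
have [q2 z2] := @rational_rV_dense z.2 m.+1%:R^-1 ltac:(by rewrite invr_gt0).
exists (pickle ((q1, q2), m)) => //; rewrite /dat pickleK.
have cz : ball (c ((q1, q2), m)) (s ((q1, q2), m)) z by [].
case: asboolP => [//|[]] y yc; apply: eU.
apply: (@le_ball _ _ _ (3 * m.+1%:R^-1)); first exact: ltW.
rewrite (_ : 3 * _ = s ((q1, q2), m) + s ((q1, q2), m) *+ 2); last first.
  by rewrite mulr_natl mulrS.
exact: (ball_triangle (ball_sym cz) yc).
Qed.

Lemma open_measurable_rV2 (U : set (V * V)) : open U -> measurable U.
Proof.
move=> /open_bigcup_ball[a [r [_ ->]]].
by apply: bigcupT_measurable => k; exact: measurable_ball_rV2.
Qed.

Lemma open_setX (A B : set V) : open A -> open B -> open (A `*` B).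
Proof.
move=> oA oB.
rewrite (_ : A `*` B = fst @^-1` A `&` snd @^-1` B)//.
apply: openI; first by apply: open_comp => // z _; exact: cvg_fst.
by apply: open_comp => // z _; exact: cvg_snd.
Qed.

(** An open set of the single space is a section of an open set of the product. *)
Lemma open_measurable_rV (U : set V) : open U -> measurable U.
Proof.
move=> oU; have /open_measurable_rV2 := open_setX openT oU.
move=> /(@measurable_xsection _ _ _ _ _ (0 : V)); congr (measurable _).
by apply/seteqP; split => x; rewrite /xsection/= inE; [case|].
Qed.

Lemma hausdorff_rV : hausdorff_space V.
Proof. exact: norm_hausdorff. Qed.

Lemma compact_measurable_rV (K : set V) : compact K -> measurable K.
Proof.
move=> /(compact_closed hausdorff_rV) cK; rewrite -[K]setCK.
by apply: measurableC; apply: open_measurable_rV; exact: closed_openC.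
Qed.

Lemma compact_measurable_rV2 (K : set (V * V)) : compact K -> measurable K.
Proof.
move=> /(compact_closed (@norm_hausdorff _ _)) cK; rewrite -[K]setCK.
by apply: measurableC; apply: open_measurable_rV2; exact: closed_openC.
Qed.

(** The coordinates are continuous, hence measurable for the sigma-algebra of
    the open sets, which therefore contains the product sigma-algebra. *)
Lemma measurable_rV2_gen_open : @measurable _ (V * V)%type = <<s @open (V * V)%type >>.
Proof.
apply/seteqP; split; last first.
  apply: smallest_sub; first exact: sigma_algebra_measurable.
  exact: open_measurable_rV2.
pose T := g_sigma_algebraType (@open (V * V)%type).
have mc (f : T -> R) : continuous (f : V * V -> R) -> measurable_fun setT f.
  move=> cf; apply: (measurability _ (RGenOInfty.measurableE R)) => /=.
  move=> _ [_ [x ->] <-]; rewrite setTI.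
  have : open ((f : V * V -> R) @^-1` `]x, +oo[).
    by apply: open_comp => [z _|]; [exact: cf|exact: interval_open].
  exact: (@sub_sigma_algebra _ setT).
have mid : measurable_fun setT (fun z : T => (z : V * V)).
  rewrite (_ : (fun z : T => _) =
    (fun z : T => ((z : V * V).1, (z : V * V).2))); last first.
    by apply/funext => -[].
  apply: measurable_fun_pair; apply: measurable_fun_coordP => i.
    apply: mc => z; apply: (@continuous_comp _ _ _ fst (fun v : V => v ord0 i)).
      exact: cvg_fst.
    exact: coord_continuous.
  apply: mc => z; apply: (@continuous_comp _ _ _ snd (fun v : V => v ord0 i)).
    exact: cvg_snd.
  exact: coord_continuous.
by move=> A mA; have := mid measurableT _ mA; rewrite setTI.
Qed.

End euclidean_topology.

(** * Integrability, and integrals of derivatives *)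

Section integrability.
Context {R : realType} {n : nat}.
Local Notation V := 'rV[R]_n.
Local Notation leb := (@lebesgue_rV R n).
Local Notation leb2 := (leb \x leb)%E.

Lemma open_preimage_gt (W : topologicalType) (D : set W) (f : W -> R) x :
  open D -> (forall z, D z -> {for z, continuous f}) ->
  open (D `&` f @^-1` `]x, +oo[).
Proof.
move=> oD cf; rewrite openE => z [Dz fz]; rewrite /interior; apply: filterI.
  exact: open_nbhs_nbhs.
by apply: (cf _ Dz); apply: open_nbhs_nbhs; split => //; exact: interval_open.
Qed.

Lemma open_continuous_measurable_rV (D : set V) (f : V -> R) : open D ->
  (forall z, D z -> {for z, continuous f}) -> measurable_fun D f.
Proof.
move=> oD cf; apply: (measurability _ (RGenOInfty.measurableE R)) => /=.
move=> _ [_ [x ->] <-]; apply: open_measurable_rV; exact: open_preimage_gt.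
Qed.

Lemma open_continuous_measurable_rV2 (D : set (V * V)) (f : V * V -> R) :
  open D -> (forall z, D z -> {for z, continuous f}) -> measurable_fun D f.
Proof.
move=> oD cf; apply: (measurability _ (RGenOInfty.measurableE R)) => /=.
move=> _ [_ [x ->] <-]; apply: open_measurable_rV2; exact: open_preimage_gt.
Qed.

Lemma compact_sub_ball (W : normedModType R) (K : set W) : compact K ->
  exists2 M, 0 < M & K `<=` ball 0 M.
Proof.
move=> /compact_bounded [M [_ hM]]; exists (`|M| + 2); first by rewrite ltr_wpDl.
move=> x Kx; rewrite -ball_normE /= sub0r normrN.
apply: (@le_lt_trans _ _ (`|M| + 1)); last by rewrite ltrD2l ltr1n.
by apply: hM => //=; rewrite (le_lt_trans (ler_norm _))// ltrDl.
Qed.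

Lemma continuous_compact_bounded (W : normedModType R) (K : set W) (f : W -> R) :
  compact K -> (forall z, K z -> {for z, continuous f}) ->
  exists2 M, 0 < M & forall z, K z -> `|f z| <= M.
Proof.
move=> cK cf.
have cfK : {within K, continuous f}.
  by apply: continuous_in_subspaceT => z /set_mem; exact: cf.
have /compact_sub_ball [M M0 hM] := continuous_compact cfK cK.
exists M => // z Kz; apply: ltW; have : ball 0 M (f z) by apply: hM; exists z.
by rewrite -ball_normE /= sub0r normrN.
Qed.

Lemma lebesgue_rV_ball_fin (a : V) r : (leb (ball a r) < +oo)%E.
Proof.
have [r0|r0] := ltP 0 r; last first.
  rewrite (_ : ball a r = set0) ?measure0//.
  by rewrite -subset0 => x /rV_ballP[]; rewrite ltNge r0.
rewrite (_ : ball a r = [set v : V | forall i, ball (a ord0 i) r (v ord0 i)]).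
  rewrite (lebesgue_rV_box (A := fun i => ball (a ord0 i) r)) => [|i]; last first.
    exact: measurable_ball.
  under eq_bigr do rewrite lebesgue_measure_ball ?(ltW r0)//.
  by rewrite prodEFin ltry.
by apply/seteqP; split => x /=; [move=> /rV_ballP[]|move=> h; apply/rV_ballP].
Qed.

Lemma lebesgue_rV2_ball_fin (a : V * V) r : (leb2 (ball a r) < +oo)%E.
Proof.
rewrite (_ : ball a r = ball a.1 r `*` ball a.2 r)//.
rewrite product_measure1E; try exact: measurable_ball_rV.
by rewrite lte_mul_pinfty// ?lebesgue_rV_ball_fin// ge0_fin_numE// lebesgue_rV_ball_fin.
Qed.

Lemma lebesgue_rV_compact_fin (K : set V) : compact K -> (leb K < +oo)%E.
Proof.
move=> cK; have [M _ KM] := compact_sub_ball cK.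
apply: le_lt_trans (lebesgue_rV_ball_fin 0 M).
apply: le_measure => //; rewrite inE; first exact: compact_measurable_rV.
exact: measurable_ball_rV.
Qed.

Lemma lebesgue_rV2_compact_fin (K : set (V * V)) :
  compact K -> (leb2 K < +oo)%E.
Proof.
move=> cK; have [M _ KM] := compact_sub_ball cK.
apply: le_lt_trans (lebesgue_rV2_ball_fin 0 M).
apply: le_measure => //; rewrite inE; first exact: compact_measurable_rV2.
exact: measurable_ball_rV2.
Qed.

Lemma bounded_integrable d (T : measurableType d)
    (mu : {measure set T -> \bar R}) (A : set T) (f : T -> R) M :
  measurable A -> (mu A < +oo)%E -> measurable_fun A f ->
  (forall z, A z -> `|f z| <= M) -> mu.-integrable A (EFin \o f).
Proof.
move=> mA fA mf fM; apply: measurable_bounded_integrable => //.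
exists M; split; first exact: num_real.
by move=> x Mx y Ay; apply: le_trans (fM y Ay) (ltW Mx).
Qed.

Lemma compact_integrable_rV (D K : set V) (f : V -> R) : open D ->
  (forall z, D z -> {for z, continuous f}) -> compact K -> K `<=` D ->
  leb.-integrable K (EFin \o f).
Proof.
move=> oD cf cK KD.
have [M _ fM] := continuous_compact_bounded cK (fun z Kz => cf z (KD _ Kz)).
apply: (bounded_integrable _ _ _ fM); first exact: compact_measurable_rV.
- exact: lebesgue_rV_compact_fin.
- apply: (measurable_funS _ KD); first exact: open_measurable_rV.
  exact: open_continuous_measurable_rV.
Qed.

Lemma compact_integrable_rV2 (D K : set (V * V)) (f : V * V -> R) : open D ->
  (forall z, D z -> {for z, continuous f}) -> compact K -> K `<=` D ->
  leb2.-integrable K (EFin \o f).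
Proof.
move=> oD cf cK KD.
have [M _ fM] := continuous_compact_bounded cK (fun z Kz => cf z (KD _ Kz)).
apply: (bounded_integrable _ _ _ fM); first exact: compact_measurable_rV2.
- exact: lebesgue_rV2_compact_fin.
- apply: (measurable_funS _ KD); first exact: open_measurable_rV2.
  exact: open_continuous_measurable_rV2.
Qed.

End integrability.

Lemma integrable_of_support d (T : measurableType d) (R : realType)
    (mu : {measure set T -> \bar R}) (K A : set T) (f : T -> R) :
  measurable K -> measurable A -> K `<=` A -> mu.-integrable K (EFin \o f) ->
  (forall z, ~ K z -> f z = 0) -> mu.-integrable A (EFin \o f).
Proof.
move=> mK mA KA iK f0.
have /(integrableS measurableT mA (@subsetT _ _)) : mu.-integrable setT (EFin \o f) => //.
rewrite (_ : EFin \o f = (EFin \o f) \_ K); first exact/(integrable_mkcond _ mK).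
apply/funext => z; rewrite patchE; case: ifPn => // /negP zK /=.
by rewrite f0// => Kz; apply: zK; rewrite inE.
Qed.

Section continuity_on_products.
Context {R : realType} {U W : normedModType R}.

Lemma continuous_pair_snd (t : U) (v : W) :
  {for v, continuous (fun v : W => (t, v))}.
Proof.
exact: (@cvg_pair _ _ _ (nbhs v) (nbhs t) (nbhs v) _ _ _ _ _ (cvg_cst t) cvg_id).
Qed.

Lemma continuous_pair_fst (t : U) (v : W) :
  {for t, continuous (fun t : U => (t, v))}.
Proof.
exact: (@cvg_pair _ _ _ (nbhs t) (nbhs t) (nbhs v) _ _ _ _ _ cvg_id (cvg_cst v)).
Qed.

Lemma continuous_swap (z : U * W) :
  {for z, continuous (fun z : U * W => (z.2, z.1))}.
Proof.
exact: (@cvg_pair _ _ _ (nbhs z) (nbhs z.2) (nbhs z.1) _ _ _ _ _ cvg_snd cvg_fst).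
Qed.

Lemma continuous_slice_fst (X : normedModType R) (g : U * W -> X) x y :
  {for (x, y), continuous g} -> {for x, continuous (g \o (fun x => (x, y)))}.
Proof.
by move=> cg; apply: continuous_comp => //; exact: continuous_pair_fst.
Qed.

End continuity_on_products.

Section integral_of_derivative.
Context {R : realType}.

Let rV_consD n (z : R) (v : 'rV[R]_n) h :
  h *: delta_mx ord0 ord0 + rV_cons (z, v) = rV_cons (h *: 1 + z, v).
Proof.
apply/rowP => j; rewrite !mxE; case: (unliftP ord0 j) => [k ->|->] /=.
  by rewrite mulr0 add0r.
by [].
Qed.

Let rV_consDlift n (z : R) (v : 'rV[R]_n) i h :
  h *: delta_mx ord0 (lift ord0 i) + rV_cons (z, v) =
  rV_cons (z, h *: delta_mx ord0 i + v).
Proof.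
apply/rowP => j; rewrite !mxE; case: (unliftP ord0 j) => [k ->|->] /=.
  by rewrite !mxE (inj_eq lift_inj).
by rewrite mulr0 add0r.
Qed.

Let rV_cons_continuous n : continuous (@rV_cons R n).
Proof.
move=> z; apply/cvg_ballP => e e0.
have : \forall y \near z, ball z e y by apply/nbhs_ballP; exists e.
apply: filterS => y [y1 /rV_ballP[_ y2]]; apply/rV_ballP; split => // j.
rewrite !mxE; case: (unliftP ord0 j) => [k _|_] /=; first exact: y2.
exact: y1.
Qed.

Let rV_cons_ball n M (z : R * 'rV[R]_n) : 0 < M ->
  ball 0 M (rV_cons z) <-> `|z.1| < M /\ ball 0 M z.2.
Proof.
move=> M0; split.
  move=> /rV_ballP[_ h]; split.
    by have := h ord0; rewrite !mxE unlift_none/= sub0r normrN.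
  by apply/rV_ballP; split => // i; have := h (lift ord0 i); rewrite !mxE liftK.
move=> [h1 /rV_ballP[_ h2]]; apply/rV_ballP; split => // i; rewrite !mxE.
case: (unliftP ord0 i) => [k _|_] /=; last by rewrite sub0r normrN.
by have := h2 k; rewrite mxE.
Qed.

(** The fundamental theorem of calculus on an interval at whose ends [g]
    vanishes. *)
Lemma integral_derivative_R (g : R -> R) M : 0 < M ->
  (forall t, derivable g t 1) -> continuous (fun t => 'D_1 g t) ->
  (forall t, M <= `|t| -> g t = 0 /\ 'D_1 g t = 0) ->
  (\int[lebesgue_measure]_t ('D_1 g t)%:E = 0)%E.
Proof.
move=> M0 dg cg g0.
have -> : (\int[lebesgue_measure]_t ('D_1 g t)%:E =
           \int[lebesgue_measure]_(t in `[(- M)%R, M]) ('D_1 g t)%:E)%E.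
  rewrite [RHS]integral_mkcond; apply: eq_integral => t _; rewrite patchE.
  case: ifPn => // /negP tM; rewrite (proj2 (g0 t _))// leNgt; apply/negP => tM'.
  by apply: tM; rewrite inE/= in_itv/= -ler_norml ltW.
have cont : continuous g.
  by move=> t; apply: differentiable_continuous; exact/derivable1_diffP.
rewrite (@continuous_FTC2 _ _ g).
- by rewrite !(fun x h => proj1 (g0 x h)) ?subee// ?normrN ger0_norm// ltW.
- by rewrite (lt_trans _ M0)// oppr_lt0.
- exact: continuous_subspaceT.
- split => [t _||]; first exact: dg.
    by apply: cvg_at_right_filter; exact: cont.
  by apply: cvg_at_left_filter; exact: cont.
- by move=> t _; rewrite derive1E.
Qed.

(** One coordinate is integrated by the fundamental theorem of calculus, the
    others by Fubini; the induction follows the recursive construction of the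
    measure, which splits off the first coordinate. *)
Lemma integral_partial_rV n (i : 'I_n) (f : 'rV[R]_n -> R) M : 0 < M ->
  (forall x, derivable f x (delta_mx ord0 i)) ->
  continuous (fun x => 'D_(delta_mx ord0 i) f x) ->
  (forall x, ~ ball 0 M x -> f x = 0 /\ 'D_(delta_mx ord0 i) f x = 0) ->
  (\int[@lebesgue_rV R n]_x ('D_(delta_mx ord0 i) f x)%:E = 0)%E.
Proof.
elim: n i f => [[]//|n IHn] i f M0 df cf f0.
set Df := fun x => 'D_(delta_mx ord0 i) f x.
have mDf : measurable_fun setT Df.
  by apply: open_continuous_measurable_rV => [|z _]; [exact: openT|exact: cf].
have iDf : (lebesgue_measure \x @lebesgue_rV R n)%E.-integrable setT
    ((EFin \o Df) \o @rV_cons R n).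
  have [C _ hC] : exists2 C, 0 < C & forall z, closed_ball 0 M z -> `|Df z| <= C.
    apply: continuous_compact_bounded => [|z _]; last exact: cf.
    apply: bounded_closed_compact; last exact: closed_ball_closed.
    exists M; split; first exact: num_real.
    move=> x Mx y; rewrite closed_ballE// /closed_ball_/= sub0r normrN.
    by move=> /le_trans; apply; exact: ltW.
  pose B : set (measurableTypeR R) := ball (0 : R) M.
  have BE t : B t <-> `|t| < M.
    by rewrite /B -ball_normE/= sub0r normrN.
  have mB : measurable B by exact: measurable_ball.
  have finB : (lebesgue_measure B < +oo)%E.
    by rewrite lebesgue_measure_ball ?(ltW M0)// ltry.
  have mBV : measurable (B `*` ball (0 : 'rV[R]_n) M).
    by apply: measurableX => //; exact: measurable_ball_rV.
  apply: (@integrable_of_support _ _ _ _ (B `*` ball (0 : 'rV[R]_n) M)) => //.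
  - apply: (bounded_integrable (M := C)) => //.
    + have E := product_measure1E lebesgue_measure (@lebesgue_rV R n) mB
        (measurable_ball_rV (0 : 'rV[R]_n) M).
      rewrite [X in (X < _)%E]E.
      by rewrite lte_mul_pinfty// ?lebesgue_rV_ball_fin// ge0_fin_numE.
    + apply: measurable_funTS; apply: measurableT_comp => //.
      exact: measurable_rV_cons.
    + move=> z [/BE z1 z2]; apply: hC; apply: subset_closed_ball.
      by apply/rV_cons_ball.
  - move=> z nz; rewrite /= /Df (proj2 (f0 _ _))// => h.
    by apply: nz; have /(rV_cons_ball _ M0)[z1 z2] := h; split => //; exact/BE.
have mEDf : measurable_fun setT (EFin \o Df) by exact/measurable_EFinP.
rewrite /= (integral_pushforward (@measurable_rV_cons R n) mEDf iDf)//.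
rewrite preimage_setT.
have [j ij|i0] := unliftP ord0 i.
- rewrite -(integral12_prod_meas1 iDf); apply: integral0_eq => t _.
  rewrite /fubini_F /=.
  pose g (v : 'rV[R]_n) := f (rV_cons (t, v)).
  have quot v : (fun h => h^-1 *: ((f \o shift (rV_cons (t, v))) (h *: delta_mx ord0 i) -
       f (rV_cons (t, v)))) =
     (fun h => h^-1 *: ((g \o shift v) (h *: delta_mx ord0 j) - g v)).
    by apply/funext => h /=; rewrite /g ij rV_consDlift.
  have Dg v : 'D_(delta_mx ord0 j) g v = Df (rV_cons (t, v)).
    by rewrite /Df /derive quot.
  under eq_integral do rewrite -Dg.
  apply: (IHn _ _ M0) => [v||v nv].
  + by have := df (rV_cons (t, v)); rewrite /derivable quot.
  + rewrite (_ : (fun x => _) = Df \o (fun v => rV_cons (t, v))); last first.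
      by apply/funext => v; exact: Dg.
    move=> v; apply: (@continuous_comp _ _ _ (fun v => rV_cons (t, v)) Df); last exact: cf.
    apply: (@continuous_comp _ _ _ (fun v => (t, v)) (@rV_cons R n)).
      exact: continuous_pair_snd.
    exact: rV_cons_continuous.
  + by rewrite Dg; apply: f0 => /(rV_cons_ball _ M0)[].
- have -> : (\int[lebesgue_measure \x @lebesgue_rV R n]_z ((EFin \o Df) \o @rV_cons R n) z =
    \int[lebesgue_measure]_t \int[@lebesgue_rV R n]_v (Df (rV_cons (t, v)))%:E)%E.
    by rewrite -(integral12_prod_meas1 iDf).
  rewrite (Fubini iDf); apply: integral0_eq => v _ /=.
  pose g (t : R) := f (rV_cons (t, v)).
  have quot t : (fun h => h^-1 *: ((f \o shift (rV_cons (t, v))) (h *: delta_mx ord0 i) -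
       f (rV_cons (t, v)))) =
     (fun h => h^-1 *: ((g \o shift t) (h *: 1) - g t)).
    by apply/funext => h /=; rewrite /g i0 rV_consD.
  have Dg t : 'D_1 g t = Df (rV_cons (t, v)).
    by rewrite /Df /derive quot.
  under eq_integral do rewrite -Dg.
  apply: (integral_derivative_R M0) => [t||t tM].
  + by have := df (rV_cons (t, v)); rewrite /derivable quot.
  + rewrite (_ : (fun x => _) = Df \o (fun t => rV_cons (t, v))); last first.
      by apply/funext => t; exact: Dg.
    move=> t; apply: (@continuous_comp _ _ _ (fun t => rV_cons (t, v)) Df); last exact: cf.
    apply: (@continuous_comp _ _ _ (fun t => (t, v)) (@rV_cons R n)).
      exact: (@continuous_pair_fst R R 'rV[R]_n).
    exact: rV_cons_continuous.
  + by rewrite Dg; apply: f0 => /(rV_cons_ball _ M0)[/=]; rewrite ltNge tM.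
Qed.

End integral_of_derivative.

(** * Calculus of functions of class C^k *)

Section C1_calculus.
Context {R : realType}.
Implicit Types W X : normedModType R.

(** The increment of [h] vanishes near [x], so the zero map is a differential. *)
Lemma differentiable_near0 W (h : W -> R) x :
  (\forall y \near x, h y = 0) -> differentiable h x.
Proof.
move=> h0.
pose z0 : {linear W -> R} := \0.
have z0c : continuous z0 by move=> y; exact: cvg_cst.
have E : h \o shift x = cst (h x) + z0 +o_ 0 id.
  apply/eqaddoP => e e0; move: h0; rewrite (near_shift 0 x) => h0.
  have hx : h x = 0 by have := nbhs_singleton h0; rewrite /= subr0 add0r.
  near=> y; rewrite (_ : (_ - _) y = 0) ?normr0 ?mulr_ge0 ?(ltW e0)//.
  rewrite !fctE hx addr0 subr0.
  by near: y; apply: filterS h0 => y /=; rewrite subr0.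
by apply/diff_locallyP; rewrite (diff_unique z0c E).
Unshelve. all: by end_near. Qed.

Lemma near_eq_continuous W (f g : W -> R) x :
  (\forall y \near x, f y = g y) -> {for x, continuous f} -> {for x, continuous g}.
Proof.
move=> fg cf; rewrite /prop_for /continuous_at -(nbhs_singleton fg).
exact: cvg_trans (near_eq_cvg fg) cf.
Qed.

Section vanishing.
Variables (W : normedModType R) (K : set W) (f : W -> R).
Hypotheses (cK : closed K) (f0 : forall x, ~ K x -> f x = 0).

Lemma near_zero_off x : ~ K x -> \forall y \near x, f y = 0.
Proof.
move=> nKx; have : \forall y \near x, (~` K) y.
  by apply: open_nbhs_nbhs; split => //; exact: closed_openC.
by apply: filterS => y; exact: f0.
Qed.

Lemma derive_zero_off v x : ~ K x -> 'D_v f x = 0.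
Proof.
move=> /near_zero_off nf; rewrite (near_eq_derive v (g := cst 0)) ?derive_cst//.
Qed.

(** Off the closed set [K] the function vanishes locally, so that regularity
    on a neighbourhood of [K] is regularity everywhere. *)
Lemma is_Ck1_setT U : K `<=` U -> is_Ck 1 U f -> is_Ck 1 setT f.
Proof.
move=> KU [df cf]; split => [x _|v x _]; have [Kx|nKx] := pselect (K x).
- by apply: df; exact: KU.
- by apply: differentiable_near0; exact: near_zero_off.
- by apply: cf; exact: KU.
- apply: (@near_cst_continuous _ _ 0).
  have : \forall y \near x, (~` K) y.
    by apply: open_nbhs_nbhs; split => //; exact: closed_openC.
  by apply: filterS => y Ky; rewrite derive_zero_off.
Qed.

End vanishing.

Lemma is_CkS W k (U : set W) f : is_Ck k.+1 U f -> is_Ck k U f.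
Proof.
elim: k f => [|k IHk] f [df cf].
  by move=> x Ux; apply: differentiable_continuous; exact: df.
by split => // v; exact: IHk (cf v).
Qed.

Lemma is_Ck_subset W k (U U' : set W) f :
  U `<=` U' -> is_Ck k U' f -> is_Ck k U f.
Proof.
move=> UU'; elim: k f => [|k IHk] f; first by move=> cf x /UU'; exact: cf.
by move=> [df cf]; split => [x /UU'|v]; [exact: df|exact: IHk (cf v)].
Qed.

Lemma is_Ck_cst W k (U : set W) (c : R) : is_Ck k U (fun=> c).
Proof.
elim: k c => [|k IHk] c; first by move=> x _; exact: cvg_cst.
split => [x _|v]; first exact: differentiable_cst.
have -> : (fun x => 'D_v (fun=> c) x) = (fun=> 0) :> (W -> R).
  by apply/funext => x; exact: derive_cst.
exact: IHk.
Qed.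

Lemma is_CkD W k (f g : W -> R) :
  is_Ck k setT f -> is_Ck k setT g -> is_Ck k setT (fun x => f x + g x).
Proof.
elim: k f g => [|k IHk] f g.
  by move=> cf cg x _; apply: cvgD; [exact: cf|exact: cg].
move=> [df cf] [dg cg]; split => [x _|v].
  by apply: differentiableD; [exact: df|exact: dg].
have -> : (fun x => 'D_v (fun x => f x + g x) x) = (fun x => 'D_v f x + 'D_v g x).
  apply/funext => x.
  by rewrite (deriveD (diff_derivable _) (diff_derivable _)); [|exact: df|exact: dg].
by apply: IHk; [exact: cf|exact: cg].
Qed.

Lemma is_CkM W k (f g : W -> R) :
  is_Ck k setT f -> is_Ck k setT g -> is_Ck k setT (fun x => f x * g x).
Proof.
elim: k f g => [|k IHk] f g.
  by move=> cf cg x _; apply: cvgM; [exact: cf|exact: cg].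
move=> Cf Cg; have [df cf] := Cf; have [dg cg] := Cg; split => [x _|v].
  by apply: differentiableM; [exact: df|exact: dg].
have -> : (fun x => 'D_v (fun x => f x * g x) x) =
    (fun x => f x * 'D_v g x + g x * 'D_v f x).
  apply/funext => x.
  by rewrite (deriveM (diff_derivable _) (diff_derivable _)); [|exact: df|exact: dg].
by apply: is_CkD; apply: IHk; [exact: is_CkS|exact: cg|exact: is_CkS|exact: cf].
Qed.

Lemma is_CkB W k (f g : W -> R) :
  is_Ck k setT f -> is_Ck k setT g -> is_Ck k setT (fun x => f x - g x).
Proof.
move=> Cf Cg; rewrite (_ : (fun x => _) = (fun x => f x + (-1) * g x)).
  by apply: (is_CkD Cf); apply: (is_CkM _ Cg); exact: is_Ck_cst.
by apply/funext => x; rewrite mulN1r.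
Qed.

Lemma is_Ck_prod W k n (f : 'I_n -> W -> R) :
  (forall i, is_Ck k setT (f i)) -> is_Ck k setT (fun x => \prod_(i < n) f i x).
Proof.
elim: n f => [|n IHn] f Cf.
  rewrite (_ : (fun x => \prod_(i < 0) f i x) = (fun=> 1)); first exact: is_Ck_cst.
  by apply/funext => x; rewrite big_ord0.
rewrite (_ : (fun x => \prod_(i < n.+1) f i x) =
  (fun x => f ord0 x * \prod_(i < n) f (lift ord0 i) x)).
  by apply: is_CkM; [exact: Cf|apply: IHn => i; exact: Cf].
by apply/funext => x; rewrite big_ord_recl.
Qed.

(** Unlike the previous ones this lemma is local: it is meant for the weight,
    which is regular on [Omega `*` Omega] only. *)
Lemma is_Ck1M W (U : set W) (f g : W -> R) : open U ->
  is_Ck 1 U f -> is_Ck 1 U g -> is_Ck 1 U (fun x => f x * g x).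
Proof.
move=> oU [df cf] [dg cg]; split => [x Ux|v x Ux].
  by apply: differentiableM; [exact: df|exact: dg].
have E : \forall y \near x,
    f y * 'D_v g y + g y * 'D_v f y = 'D_v (fun x => f x * g x) y.
  have : \forall y \near x, U y by apply: open_nbhs_nbhs.
  apply: filterS => y Uy.
  by rewrite (deriveM (diff_derivable _) (diff_derivable _)); [|exact: df|exact: dg].
apply: (near_eq_continuous E).
apply: cvgD; apply: cvgM.
- exact/differentiable_continuous/df.
- exact: cg.
- exact/differentiable_continuous/dg.
- exact: cf.
Qed.

Lemma derive_comp_linear W X (l : {linear W -> X}) (f : X -> R) v x :
  'D_v (f \o l) x = 'D_(l v) f (l x).
Proof.
rewrite /derive (_ : (fun h => _) =
  (fun h => h^-1 *: ((f \o shift (l x)) (h *: l v) - f (l x))))//.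
by apply/funext => h /=; rewrite linearP.
Qed.

Lemma is_Ck1_comp_linear W X (l : {linear W -> X}) (f : X -> R) :
  continuous l -> is_Ck 1 setT f -> is_Ck 1 setT (f \o l).
Proof.
move=> cl [df cf]; split => [x _|v x _].
  by apply: differentiable_comp; [exact: linear_differentiable|exact: df].
rewrite (_ : (fun x => _) = (fun y => 'D_(l v) f y) \o l); last first.
  by apply/funext => y; exact: derive_comp_linear.
by apply: continuous_comp; [exact: cl|exact: cf].
Qed.

End C1_calculus.

(** * The nonlocal gradient of a smooth function *)

Section integral_on_product.
Context {R : realType} {n : nat}.
Local Notation V := 'rV[R]_n.
Local Notation leb := (@lebesgue_rV R n).
Local Notation leb2 := (leb \x leb)%E.

Lemma integral_swap (f : V * V -> \bar R) :
  leb2.-integrable setT f -> leb2.-integrable setT (f \o (fun z => (z.2, z.1))) ->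
  (\int[leb2]_z f (z.2, z.1) = \int[leb2]_z f z)%E.
Proof.
move=> if1 if2; rewrite -(integral12_prod_meas1 if1) -(integral12_prod_meas1 if2).
by rewrite /fubini_F /= (Fubini if1).
Qed.

Lemma compact_integrable_setT_rV2 (K : set (V * V)) (f : V * V -> R) :
  compact K -> continuous f -> (forall z, ~ K z -> f z = 0) ->
  leb2.-integrable setT (EFin \o f).
Proof.
move=> cK cf f0; apply: (integrable_of_support _ _ _ _ f0) => //.
  exact: compact_measurable_rV2.
exact: (compact_integrable_rV2 openT (fun z _ => cf z)).
Qed.

Lemma compact_integrable_setT_rV (K : set V) (f : V -> R) :
  compact K -> continuous f -> (forall z, ~ K z -> f z = 0) ->
  leb.-integrable setT (EFin \o f).
Proof.
move=> cK cf f0; apply: (integrable_of_support _ _ _ _ f0) => //.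
  exact: compact_measurable_rV.
exact: (compact_integrable_rV openT (fun z _ => cf z)).
Qed.

Let slice_quotient i (f : V * V -> R) x y :
  (fun h => h^-1 *: ((f \o shift (x, y)) (h *: (delta_mx ord0 i, 0)) - f (x, y))) =
  (fun h => h^-1 *: (((fun x' => f (x', y)) \o shift x) (h *: delta_mx ord0 i) - f (x, y))).
Proof.
apply/funext => h /=; do 3 f_equal.
by apply: injective_projections; rewrite //= scaler0 add0r.
Qed.

Lemma derive_slice i (f : V * V -> R) x y :
  'D_(delta_mx ord0 i, 0) f (x, y) = 'D_(delta_mx ord0 i) (fun x' => f (x', y)) x.
Proof.
by rewrite /derive slice_quotient.
Qed.

(** The inner integral is that of a partial derivative on a slice. *)
Lemma integral_partial_rV2 i (K : set (V * V)) (f : V * V -> R) :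
  compact K -> is_Ck 1 setT f -> (forall z, ~ K z -> f z = 0) ->
  (\int[leb2]_z ('D_(delta_mx ord0 i, 0) f z)%:E = 0)%E.
Proof.
move=> cK [df cf] f0.
have clK : closed K by exact: compact_closed (@norm_hausdorff _ _) cK.
have D0 z : ~ K z -> 'D_(delta_mx ord0 i, 0) f z = 0 by exact: derive_zero_off.
have iD : leb2.-integrable setT (EFin \o (fun z => 'D_(delta_mx ord0 i, 0) f z)).
  by apply: (compact_integrable_setT_rV2 cK _ D0) => z; exact: cf.
have [M M0 KM] := compact_sub_ball cK.
rewrite -(integral12_prod_meas1 iD) (Fubini iD); apply: integral0_eq => y _ /=.
under eq_integral do rewrite derive_slice.
apply: (integral_partial_rV M0) => [x||x nx].
- have := @diff_derivable _ _ _ f (x, y) (delta_mx ord0 i, 0) (df (x, y) I).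
  by rewrite /derivable slice_quotient.
- have E : (fun x => 'D_(delta_mx ord0 i) (fun x' => f (x', y)) x) =
      (fun z => 'D_(delta_mx ord0 i, 0) f z) \o (fun x => (x, y)).
    by apply/funext => x /=; rewrite derive_slice.
  by rewrite E => x; apply: continuous_slice_fst; exact: cf.
- have nK : ~ K (x, y) by move=> /KM[].
  by rewrite f0// -derive_slice D0.
Qed.

End integral_on_product.

Definition swap (R : realType) (W : normedModType R) (z : W * W) : W * W := (z.2, z.1).

Lemma swap_is_linear (R : realType) (W : normedModType R) : linear (@swap R W).
Proof. by []. Qed.

HB.instance Definition _ (R : realType) (W : normedModType R) :=
  GRing.isLinear.Build R (W * W)%type (W * W)%type _ (@swap R W) (@swap_is_linear R W).

Section nonlocal_gradient.
Context {R : realType} {n : nat}.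
Local Notation V := 'rV[R]_n.
Local Notation leb := (@lebesgue_rV R n).
Local Notation leb2 := (leb \x leb)%E.
Variables (Omega : set V) (w : V * V -> R).
Hypotheses (oO : open Omega) (hw : admissible Omega w).

Let oOO : open (Omega `*` Omega). Proof. exact: open_setX. Qed.

Lemma admissible_continuous z : (Omega `*` Omega) z -> {for z, continuous w}.
Proof. by case: hw => -[dw _] _ _ Oz; exact/differentiable_continuous/dw. Qed.

Lemma compact_support_setU_swap (K : set (V * V)) :
  compact K -> K `<=` Omega `*` Omega ->
  compact (K `|` @swap R V @` K) /\ K `|` @swap R V @` K `<=` Omega `*` Omega.
Proof.
move=> cK KO; split.
  apply: compactU => //; apply: continuous_compact => //.
  by apply: continuous_subspaceT => z; exact: continuous_swap.
by move=> z [/KO//|[y /KO[y1 y2] <-]].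
Qed.

Lemma is_Ck1_swap (f : V * V -> R) : is_Ck 1 setT f -> is_Ck 1 setT (f \o @swap R V).
Proof.
move=> Cf; apply: (@is_Ck1_comp_linear R _ _ (@swap R V)) => //.
by move=> z; exact: continuous_swap.
Qed.

Lemma is_Ck1_fst (f : V -> R) : is_Ck 1 setT f ->
  is_Ck 1 setT (fun z : V * V => f z.1).
Proof.
move=> Cf; apply: (@is_Ck1_comp_linear R (V * V)%type V fst f) => //.
by move=> z; exact: cvg_fst.
Qed.

(** The candidate for the weak nonlocal gradient of a differentiable function. *)
Definition nl_grad (u : V -> R) (i : 'I_n) (z : V * V) : R :=
  w z * ('D_(delta_mx ord0 i) u z.2 - 'D_(delta_mx ord0 i) u z.1).

Section adjoint.
Variables (u : V -> R) (Cu : is_Ck 1 setT u).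
Variables (psi : V * V -> R) (K : set (V * V)).
Hypotheses (Cpsi : is_Ck 1 setT psi) (cK : compact K) (KO : K `<=` Omega `*` Omega).
Hypothesis psi0 : forall z, ~ K z -> psi z = 0.
Variable i : 'I_n.
Let Di (f : V -> R) x := 'D_(delta_mx ord0 i) f x.

Let K' := K `|` @swap R V @` K.
Let cK' : compact K'. Proof. by have [] := compact_support_setU_swap cK KO. Qed.
Let K'O : K' `<=` Omega `*` Omega.
Proof. by have [] := compact_support_setU_swap cK KO. Qed.

Let F z := w z * (psi (swap z) - psi z).

Let F0 z : ~ K' z -> F z = 0.
Proof.
move=> nz; rewrite /F (psi0 (z := z)) => [|Kz]; last by apply: nz; left.
rewrite psi0 ?subrr ?mulr0// => Kz; apply: nz; right.
by exists (swap z) => //; case: (z).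
Qed.

Let closedK' : closed K'.
Proof. exact: compact_closed (@norm_hausdorff _ _) cK'. Qed.

Let CF : is_Ck 1 setT F.
Proof.
apply: (is_Ck1_setT closedK' F0 K'O); apply: is_Ck1M => //; first by case: hw.
apply: (is_Ck_subset (@subsetT _ _)); apply: is_CkB; last exact: Cpsi.
exact: is_Ck1_swap.
Qed.

Let H z := 'D_(delta_mx ord0 i, 0) F z.

Let H0 z : ~ K' z -> H z = 0.
Proof. exact: derive_zero_off. Qed.

Let cH : continuous H. Proof. by move=> z; case: CF => _; exact. Qed.

Let cu : continuous u.
Proof. by move=> x; apply: differentiable_continuous; case: Cu => du _; exact: du. Qed.

Let cu1 : continuous (fun z : V * V => u z.1).
Proof. by move=> z; apply: (@continuous_comp _ _ _ fst u); [exact: cvg_fst|exact: cu]. Qed.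

Let uH_integrable : leb2.-integrable setT (EFin \o (fun z => u z.1 * H z)).
Proof.
apply: (compact_integrable_setT_rV2 cK').
  by move=> z; apply: cvgM; [exact: cu1|exact: cH].
by move=> z nz; rewrite H0 ?mulr0.
Qed.

Let adjE x : (u x * nl_partial_adj Omega w i psi x)%:E =
  fubini_F leb (EFin \o (fun z => u z.1 * H z)) x.
Proof.
have -> : nl_partial_adj Omega w i psi x = fine (\int[leb]_y (H (x, y))%:E)%E.
  rewrite /nl_partial_adj /Rintegral [in LHS]integral_mkcond; f_equal.
  apply: eq_integral => y _; rewrite patchE; case: ifPn => Oy.
    by rewrite /H derive_slice.
  by rewrite H0// => /K'O[_ /=]; rewrite -inE; exact/negP.
have iH : leb.-integrable setT (EFin \o (fun y => H (x, y))).
  apply: (@compact_integrable_setT_rV _ _ (snd @` K')).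
  - apply: continuous_compact => //.
    by apply: continuous_subspaceT => z; exact: cvg_snd.
  - by move=> y; apply: continuous_comp; [exact: continuous_pair_snd|exact: cH].
  - by move=> y ny; rewrite H0// => Ky; apply: ny; exists (x, y).
rewrite /fubini_F /= EFinM fineK; last exact: integrable_fin_num.
by rewrite -integralZl.
Qed.

Lemma nl_partial_adj_integrable :
  leb.-integrable Omega (EFin \o (fun x => u x * nl_partial_adj Omega w i psi x)).
Proof.
apply: (integrableS measurableT) => //; first exact: open_measurable_rV.
by under [X in _.-integrable _ X]eq_fun do rewrite /= adjE; exact: integrable_fubini_F.
Qed.

Hypothesis u0 : forall x, ~ Omega x -> u x = 0.

Let cDu : continuous (fun x => Di u x).
Proof. by move=> x; case: Cu => _; exact. Qed.

Let restrict_integrable (f : V * V -> R) :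
  (forall z, (Omega `*` Omega) z -> {for z, continuous f}) ->
  leb2.-integrable setT (EFin \o (fun z => f z * psi z)).
Proof.
move=> cf.
apply: (integrable_of_support (compact_measurable_rV2 cK) measurableT) => //.
  apply: (compact_integrable_rV2 oOO) => // z Oz.
  apply: cvgM; first exact: cf.
  by apply: differentiable_continuous; case: Cpsi => d _; exact: d.
by move=> z nz; rewrite psi0 ?mulr0.
Qed.

Let cD1 : continuous (fun z : V * V => Di u z.1).
Proof.
move=> z; apply: (@continuous_comp _ _ _ fst (fun x => Di u x)); last exact: cDu.
exact: cvg_fst.
Qed.

Let cD2 : continuous (fun z : V * V => Di u z.2).
Proof.
move=> z; apply: (@continuous_comp _ _ _ snd (fun x => Di u x)); last exact: cDu.
exact: cvg_snd.
Qed.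

Lemma nl_grad_continuous z : (Omega `*` Omega) z -> {for z, continuous (nl_grad u i)}.
Proof.
move=> Oz; apply: cvgM; first exact: admissible_continuous.
by apply: cvgB; [exact: cD2|exact: cD1].
Qed.

Lemma nl_grad_psi_integrable :
  leb2.-integrable (Omega `*` Omega) (EFin \o (fun z => nl_grad u i z * psi z)).
Proof.
apply: (integrableS measurableT) => //; first exact: open_measurable_rV2.
by apply: restrict_integrable => z; exact: nl_grad_continuous.
Qed.

Let a z := w z * Di u z.2 * psi z.
Let b z := w z * Di u z.1 * psi z.

Let ia : leb2.-integrable setT (EFin \o a).
Proof.
apply: restrict_integrable => z Oz; apply: cvgM; first exact: admissible_continuous.
exact: cD2.
Qed.

Let ib : leb2.-integrable setT (EFin \o b).
Proof.
apply: restrict_integrable => z Oz; apply: cvgM; first exact: admissible_continuous.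
exact: cD1.
Qed.

Let FDE z : F z * Di u z.1 = a (swap z) - b z.
Proof.
rewrite /F mulrBr mulrBl; congr (_ - _); last by rewrite /b mulrAC.
rewrite /a /swap /=; have [Kz|nKz] := pselect (K (swap z)); last first.
  by rewrite -/(swap z) psi0// !(mulr0, mul0r).
have [/= Oz2 Oz1] := KO Kz; have [_ _ wC] := hw.
by rewrite -{1}[z]/(z) (surjective_pairing z) /= (wC _ _ Oz1 Oz2) mulrAC.
Qed.

(** Integration by parts in the first variable moves the derivative on [u];
    exchanging the two variables and the symmetry of the weight then turn
    [psi (y, x)] into [psi (x, y)], which produces the difference of the two
    derivatives of [u]. *)
Lemma integral_nl_partial_adj :
  (\int[leb]_(x in Omega) (u x * nl_partial_adj Omega w i psi x)%:E =
   - \int[leb2]_(z in Omega `*` Omega) (nl_grad u i z * psi z)%:E)%E.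
Proof.
have -> : (\int[leb]_(x in Omega) (u x * nl_partial_adj Omega w i psi x)%:E =
    \int[leb2]_z (u z.1 * H z)%:E)%E.
  rewrite integral_mkcond -(integral12_prod_meas1 uH_integrable).
  apply: eq_integral => x _; rewrite patchE -adjE.
  have [Ox|nOx] := pselect (Omega x); first by rewrite mem_set.
  by rewrite memNset// u0// mul0r.
have -> : (\int[leb2]_(z in Omega `*` Omega) (nl_grad u i z * psi z)%:E =
    \int[leb2]_z ((a z)%:E - (b z)%:E))%E.
  rewrite integral_mkcond; apply: eq_integral => z _; rewrite patchE.
  have [Oz|nOz] := pselect ((Omega `*` Omega) z).
    by rewrite mem_set// -EFinB /a /b /nl_grad mulrBr mulrBl.
  by rewrite memNset// /a /b psi0 ?mulr0 ?subee// => /KO.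
have iFD : leb2.-integrable setT (EFin \o (fun z => F z * Di u z.1)).
  apply: (compact_integrable_setT_rV2 cK') => [z|z nz]; last by rewrite F0 ?mul0r.
  apply: cvgM; last exact: cD1.
  by apply: differentiable_continuous; case: CF => d _; exact: d.
have CuF : is_Ck 1 setT (fun z => u z.1 * F z).
  by apply: (is_CkM _ CF); exact: is_Ck1_fst.
have uF0 z : ~ K' z -> u z.1 * F z = 0 by move=> nz; rewrite F0 ?mulr0.
have ias : leb2.-integrable setT (EFin \o a \o @swap R V).
  rewrite (_ : EFin \o a \o @swap R V =
    (EFin \o (fun z => F z * Di u z.1)) \+ (EFin \o b)); first exact: integrableD.
  by apply/funext => z /=; rewrite FDE -EFinD subrK.
have : (\int[leb2]_z ((u z.1 * H z)%:E + (F z * Di u z.1)%:E) = 0)%E.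
  rewrite -[RHS](integral_partial_rV2 i cK' CuF uF0).
  apply: eq_integral => z _.
  have [[du1 _] [dF _]] := (is_Ck1_fst Cu, CF).
  rewrite (deriveM (diff_derivable _) (diff_derivable _)); [|exact: du1|exact: dF].
  by rewrite -EFinD; congr (_ + _)%:E; congr (_ * _).
rewrite integralD//= => E.
rewrite -[LHS](@addeK _ (\int[leb2]_z (F z * Di u z.1)%:E)%E); last first.
  exact: integrable_fin_num.
rewrite E add0e; congr (- _)%E.
under [in LHS]eq_integral do rewrite FDE EFinB.
rewrite (integralB measurableT ias ib) (integralB measurableT ia ib); congr (_ - _)%E.
exact: (integral_swap ia ias).
Qed.

End adjoint.
End nonlocal_gradient.

(** * Smooth bump functions and cutoffs *)

Section flat_function.
Context {R : realType}.

(** The functions [t ^- m * exp (- 1 / t)] extended by zero: this family is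
    stable under differentiation up to linear combinations, so that all the
    derivatives of the classical flat function [flat 0] are obtained at once. *)
Definition flat (m : nat) (t : R) : R :=
  if 0 < t then t^-1 ^+ m * expR (- t^-1) else 0.

Lemma flat_gt0 m t : 0 < t -> 0 < flat m t.
Proof. by move=> t0; rewrite /flat t0 mulr_gt0 ?expR_gt0// exprn_gt0// invr_gt0. Qed.

Lemma flat_eq0 m t : t <= 0 -> flat m t = 0.
Proof. by rewrite /flat leNgt => /negbTE ->. Qed.

Lemma flat_ge0 m t : 0 <= flat m t.
Proof. by have [/flat_eq0->//|/(flat_gt0 m)/ltW] := leP t 0. Qed.

(** With [k = m.+1], the inequality [1 + y <= expR y] at [y = t^-1 / k] gives
    [(t^-1 / k) ^+ k <= expR (t^-1)], and one power of [t] is left over. *)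
Lemma flat_le m t : `|flat m t| <= m.+1%:R ^+ m.+1 * `|t|.
Proof.
rewrite ger0_norm ?flat_ge0//; have [t0|t0] := leP t 0.
  by rewrite flat_eq0// mulr_ge0// exprn_ge0.
rewrite /flat t0 (gtr0_norm t0).
have E : (t^-1 / m.+1%:R) ^+ m.+1 <= expR (t^-1).
  rewrite -[in leRHS](@divfK _ m.+1%:R _ t^-1)// [in leRHS]mulrC expRM_natl.
  apply: lerXn2r; rewrite ?nnegrE ?expR_ge0//.
    by rewrite mulr_ge0 ?invr_ge0 ?(ltW t0).
  by apply: le_trans (expR_ge1Dx _); rewrite lerDr.
rewrite expRN ler_pdivrMr ?expR_gt0//.
apply: le_trans (ler_wpM2l _ E); last by rewrite mulr_ge0 ?exprn_ge0 ?(ltW t0).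
rewrite expr_div_n [_ * t]mulrC -mulrA [m.+1%:R ^+ _ * _]mulrC divfK ?expf_neq0//.
by rewrite exprS mulrA divff ?gt_eqF// mul1r.
Qed.

Lemma flat_continuous0 m : flat m t @[t --> 0] --> 0.
Proof.
apply/cvgr0Pnorm_le => e e0; pose C := m.+1%:R ^+ m.+1 : R.
have C0 : 0 < C by rewrite exprn_gt0.
have : \forall t \near (0 : R), `|t| < e / C.
  by apply: nbhs0_lt; rewrite divr_gt0.
apply: filterS => t te; apply: le_trans (flat_le m t) _.
by rewrite -ler_pdivlMl// mulrC ltW.
Qed.

(** At the origin the difference quotient of [flat m] is [flat m.+1], which
    tends to zero. *)
Lemma is_derive_flat (m : nat) (t : R) :
  is_derive t (1 : R) (flat m) (flat m.+2 t - m%:R * flat m.+1 t).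
Proof.
have [t0|t0|->] := ltgtP t 0.
- rewrite !flat_eq0 ?ltW// mulr0 subr0.
  apply: (@near_eq_is_derive _ _ _ (cst 0)).
  near=> s; rewrite flat_eq0// ltW//; near: s; exact: lt_nbhsl.
- apply: (@near_eq_is_derive R R R (fun s : R => s^-1 ^+ m * expR (- s^-1))).
    near=> s; rewrite /flat ifT//; near: s; exact: lt_nbhsr.
  have tn0 : t != 0 by rewrite gt_eqF.
  pose s := t^-1; have d1 : is_derive t (1 : R) (fun y : R => y^-1) (- s ^+ 2).
    by apply: is_derive_eq (is_deriveV tn0 (is_derive_id t (1 : R))) _; rewrite /s exprVn [LHS]mulr1.
  have d2 := is_deriveM (is_deriveX m d1) (is_derive1_comp (is_derive_expR _) (is_deriveN d1)).
  rewrite (_ : (fun y : R => y^-1 ^+ m * expR (- y^-1)) =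
    ((fun y : R => y^-1) ^+ m * (expR \o (- (fun y : R => y^-1))))); last first.
    by apply/funext => y; rewrite !fctE.
  apply: is_derive_eq d2 _; rewrite /flat t0 !fctE -/s /GRing.scale /=.
  by case: (m) => [|k]; rewrite ?expr0 ?exprS /=; ring.
- rewrite !(flat_eq0 _ (lexx 0)) mulr0 subr0.
  have E : (fun h : R => h^-1 *: ((flat m \o shift 0) (h *: 1) - flat m 0)) @ 0^' --> 0.
    apply: cvg_trans (cvg_within_filter _ (flat_continuous0 m.+1)).
    apply: near_eq_cvg; near=> h.
    rewrite /= addr0 (flat_eq0 m (lexx 0)) subr0 /flat [h *: 1]mulr1.
    case: ifPn => h0; last by rewrite scaler0.
    by rewrite exprS -mulrA.
  apply: DeriveDef; first by apply/cvg_ex; exists 0.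
  exact/cvg_lim.
Unshelve. all: by end_near. Qed.

End flat_function.

Section smooth_functions.
Context {R : realType} {n : nat}.
Local Notation V := 'rV[R]_n.

(** Induction on the order for all [m] at once: a derivative of [flat m] is a
    combination of [flat m.+1] and [flat m.+2]. *)
Lemma is_Ck_flat k m (c d : R) (i : 'I_n) :
  is_Ck k setT (fun x : V => flat m (c * x ord0 i + d)).
Proof.
pose l (x : V) := c * x ord0 i + d.
have dl x v : is_derive (0 : R) (1 : R) (fun h : R => l (h *: v + x)) (c * v ord0 i).
  rewrite (_ : (fun h : R => l (h *: v + x)) = (fun h => h * (c * v ord0 i) + l x)); last first.
    by apply/funext => h; rewrite /l !mxE; ring.
  by apply: is_derive_eq; rewrite /GRing.scale /=; ring.
have dfl j (x : V) : differentiable (fun x : V => flat j (l x)) x.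
  apply: (@differentiable_comp _ _ _ _ l (flat j)); last first.
    apply/derivable1_diffP; have H := @is_derive_flat R j (l x); exact: ex_derive.
  apply: (@differentiableD _ _ _ (fun x : V => c * x ord0 i) (cst d)).
    apply: (@differentiableM _ _ (cst c) (fun x : V => x ord0 i)) => //.
    exact: differentiable_coord.
  exact: differentiable_cst.
have Dfl j (x v : V) : 'D_v (fun x : V => flat j (l x)) x =
    (flat j.+2 (l x) + (- j%:R) * flat j.+1 (l x)) * (c * v ord0 i).
  have H1 := @is_derive_flat R j (l (0 *: v + x)).
  have H := @is_derive1_comp R (flat j) (fun h : R => l (h *: v + x)) 0 _ _ H1 (dl x v).
  have -> : 'D_v (fun x : V => flat j (l x)) x =
      'D_1 (flat j \o (fun h : R => l (h *: v + x))) 0.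
    pose G := flat j \o (fun h : R => l (h *: v + x)).
    have q : (fun h => h^-1 *:
          (((fun x : V => flat j (l x)) \o shift x) (h *: v) - flat j (l x))) =
        (fun h => h^-1 *: ((G \o shift 0) (h *: 1) - G 0)).
      by apply/funext => h /=; rewrite /G /= !(scale0r, add0r, addr0) [h *: 1]mulr1.
    by rewrite /derive q.
  by rewrite derive_val scale0r add0r mulNr.
elim: k m => [|k IHk] m.
  by move=> x _; apply: differentiable_continuous; exact: dfl.
split => [x _|v]; first exact: dfl.
have -> : (fun x => 'D_v (fun x : V => flat m (c * x ord0 i + d)) x) =
    (fun x => (flat m.+2 (l x) + (- m%:R) * flat m.+1 (l x)) * (c * v ord0 i)).
  by apply/funext => x; exact: Dfl.
apply: is_CkM; last exact: is_Ck_cst.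
apply: is_CkD; first exact: IHk.
by apply: is_CkM; [exact: is_Ck_cst|exact: IHk].
Qed.

End smooth_functions.

Section bumps.
Context {R : realType} {n : nat}.
Local Notation V := 'rV[R]_n.

(** Smooth, and positive exactly on the ball of the sup norm. The constant
    factor makes the function vanish when the ball is empty for want of a
    positive radius. *)
Definition ball_bump (a : V) (r : R) (x : V) : R :=
  flat 0 r * \prod_(i < n)
    (flat 0 (1 * x ord0 i + (r - a ord0 i)) * flat 0 (-1 * x ord0 i + (r + a ord0 i))).

Lemma ball_bump_ge0 a r x : 0 <= ball_bump a r x.
Proof. by rewrite mulr_ge0 ?flat_ge0// prodr_ge0// => i _; rewrite mulr_ge0 ?flat_ge0. Qed.

Let ball_bump_factor (a : V) r (x : V) i :
  0 < 1 * x ord0 i + (r - a ord0 i) /\ 0 < -1 * x ord0 i + (r + a ord0 i) <->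
  `|a ord0 i - x ord0 i| < r.
Proof. by rewrite ltr_norml; split => [[? ?]|/andP[? ?]]; [apply/andP|]; split; lra. Qed.

Lemma ball_bump_gt0 a r x : ball a r x -> 0 < ball_bump a r x.
Proof.
move=> /rV_ballP[r0 h]; rewrite mulr_gt0 ?flat_gt0// prodr_gt0// => i _.
by have /ball_bump_factor[? ?] := h i; rewrite mulr_gt0// flat_gt0.
Qed.

Lemma ball_bump_eq0 a r x : ~ ball a r x -> ball_bump a r x = 0.
Proof.
move=> nb; apply/eqP; apply: contra_notT nb => /[dup] b0.
rewrite mulf_eq0 negb_or => /andP[r0 /prodf_neq0 p0]; apply/rV_ballP.
have gt0 t : flat 0 t != 0 -> 0 < t.
  by move=> ft; rewrite ltNge; apply: contra ft => /flat_eq0 ->.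
split => [|i]; first exact: gt0.
apply/ball_bump_factor; have := p0 i isT; rewrite mulf_eq0 negb_or => /andP[? ?].
by split; exact: gt0.
Qed.

Lemma is_Ck_bump k a r : is_Ck k setT (ball_bump a r).
Proof.
apply: is_CkM; first exact: is_Ck_cst.
by apply: is_Ck_prod => i; apply: is_CkM; exact: is_Ck_flat.
Qed.

Lemma compact_closed_ball (a : V) r : compact (closed_ball a r).
Proof.
apply: bounded_closed_compact; last exact: closed_ball_closed.
have [r0|r0] := ltP 0 r; last first.
  by rewrite closed_ball0//; exact: (compact_bounded (@compact0 _)).
exists (`|a| + r); split; first exact: num_real.
move=> M rM x; rewrite closed_ballE// /closed_ball_/= => xr.
rewrite -[x](subKr a) (le_trans (ler_normB _ _))// (le_trans _ (ltW rM))//.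
by rewrite lerD2l.
Qed.

Lemma closed_ball_sub_ball (W : normedModType R) (a : W) r s : r < s ->
  closed_ball a r `<=` ball a s.
Proof.
move=> rs x; have [r0|r0] := ltP 0 r; last by rewrite closed_ball0.
rewrite closed_ballE// -ball_normE /closed_ball_/= => /le_lt_trans; exact.
Qed.

Lemma supported_compact (W : normedModType R) (U K : set W) (f : W -> R) :
  compact K -> K `<=` U -> (forall x, ~ K x -> f x = 0) ->
  compactly_supported U f.
Proof.
move=> cK KU f0.
have clK : closed K by exact: compact_closed (@norm_hausdorff _ _) cK.
have suppK : closure [set x | f x != 0] `<=` K.
  rewrite (closure_id K).1//; apply: closure_subset => x /= fx.
  by apply: contrapT => /f0 fx0; rewrite fx0 eqxx in fx.
split; last exact: subset_trans suppK KU.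
by apply: (subclosed_compact _ cK suppK); exact: closed_closure.
Qed.

Lemma ball_bump_off_closed_ball a r x : ~ closed_ball a r x -> ball_bump a r x = 0.
Proof. by move=> nx; apply: ball_bump_eq0 => /subset_closed_ball. Qed.

Lemma Cinfty_c_bump (U : set V) a r : closed_ball a r `<=` U ->
  Cinfty_c U (ball_bump a r).
Proof.
move=> aU; split.
  by move=> k; apply: (is_Ck_subset (@subsetT _ U)); exact: is_Ck_bump.
apply: (supported_compact _ aU); first exact: compact_closed_ball.
exact: ball_bump_off_closed_ball.
Qed.

End bumps.

Section cutoffs.
Context {R : realType} {n : nat}.
Local Notation V := 'rV[R]_n.

Let bump2 (a : V * V) r (z : V * V) := ball_bump a.1 r z.1 * ball_bump a.2 r z.2.

Let bump2_ge0 a r z : 0 <= bump2 a r z.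
Proof. by rewrite mulr_ge0 ?ball_bump_ge0. Qed.

Let Cbump2 a r : is_Ck 1 setT (bump2 a r).
Proof.
apply: is_CkM.
  by apply: is_Ck1_fst; exact: is_Ck_bump.
apply: (@is_Ck1_comp_linear R (V * V)%type V snd); last exact: is_Ck_bump.
by move=> z; exact: cvg_snd.
Qed.

Lemma is_Ck1V (W : normedModType R) (f : W -> R) : (forall x, f x != 0) ->
  is_Ck 1 setT f -> is_Ck 1 setT (fun x => (f x)^-1).
Proof.
move=> fn0 [df cf].
have dV x : differentiable (fun x => (f x)^-1) x.
  by apply: differentiableV; [exact: df|exact: fn0].
split => [x _|v x _]; first exact: dV.
have E : (fun x => 'D_v (fun x => (f x)^-1) x) =
    (fun x => - ((f x)^-1 * (f x)^-1) * 'D_v f x).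
  apply/funext => y.
  by rewrite deriveV//; [rewrite -expr2 exprVn|apply: diff_derivable; exact: df].
rewrite E; apply: cvgM; last exact: cf.
by apply: cvgN; apply: cvgM; exact: (differentiable_continuous (dV x)).
Qed.

(** If the open balls with closures in [U] cover [U], then [m] times the sum
    of the first [m] bumps tends to infinity exactly on [U], and composing with
    [t / (1 + t)] keeps the values below one. *)
Lemma exists_cutoffs (U : set (V * V)) : open U ->
  exists chi : nat -> V * V -> R,
    [/\ forall m, Ck_c 1 U (chi m),
        forall m z, 0 <= chi m z <= 1,
        forall z, nondecreasing_seq (chi ^~ z) &
        forall z, U z -> chi m z @[m --> \oo] --> (1 : R)].
Proof.
move=> oU; have [a [r [arU UE]]] := open_bigcup_ball oU.
pose S m z := \sum_(k < m) bump2 (a k) (r k) z.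
have S_ge0 m z : 0 <= S m z by apply: sumr_ge0 => k _.
pose T m z := m%:R * S m z.
have T_ge0 m z : 0 <= T m z by rewrite mulr_ge0.
have T1 m z : 0 < 1 + T m z by rewrite ltr_pwDl.
have S_nd z : {homo (fun m => S m z) : p q / (p <= q)%N >-> p <= q}.
  by apply: homo_leq => // [? ? ?|m]; [exact: le_trans|rewrite /S big_ord_recr lerDl].
have T_nd z : {homo (fun m => T m z) : p q / (p <= q)%N >-> p <= q}.
  by move=> p q pq; apply: ler_pM => //; [rewrite ler_nat|exact: S_nd].
have CS m : is_Ck 1 setT (S m).
  elim: m => [|m IHm].
    rewrite (_ : S 0 = (fun=> 0)); first exact: is_Ck_cst.
    by apply/funext => z; rewrite /S big_ord0.
  rewrite (_ : S m.+1 = (fun z => S m z + bump2 (a m) (r m) z)).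
    by apply: (is_CkD IHm); exact: Cbump2.
  by apply/funext => z; rewrite /S big_ord_recr.
have CT1 m : is_Ck 1 setT (fun z => 1 + T m z).
  apply: is_CkD; first exact: is_Ck_cst.
  by apply: is_CkM; [exact: is_Ck_cst|exact: CS].
exists (fun m z => 1 - (1 + T m z)^-1); split.
- move=> m; split.
    apply: (is_Ck_subset (@subsetT _ U)); apply: is_CkB.
      exact: is_Ck_cst.
    by apply: is_Ck1V (CT1 m) => z; rewrite gt_eqF.
  pose B k := closed_ball (a k).1 (r k) `*` closed_ball (a k).2 (r k).
  apply: (@supported_compact _ _ _ (\big[setU/set0]_(k < m) B k)).
  + apply: bigsetU_compact => k _; apply: compact_setX; exact: compact_closed_ball.
  + rewrite -bigcup_mkord; apply: bigcup_sub => k _ z [z1 z2]; apply: (arU k).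
    have r0 : 0 < r k.
      by rewrite ltNge; apply/negP => r0; move: z1; rewrite closed_ball0.
    by split; apply: closed_ball_sub_ball; rewrite ?ltr_pMn2l//; [|exact: z1| |exact: z2];
      rewrite mulr2n ltrDl.
  + rewrite -bigcup_mkord => z nz; rewrite /T /S big1 ?mulr0 ?addr0 ?invr1 ?subrr//.
    move=> k _; apply/eqP; rewrite mulf_eq0; apply/negPn/negP.
    rewrite negb_or => /andP[b1 b2]; apply: nz; exists k => //=.
    split; apply: contrapT => /ball_bump_off_closed_ball b0.
      by rewrite b0 eqxx in b1.
    by rewrite b0 eqxx in b2.
- move=> m z; rewrite subr_ge0 gerBl invr_ge0 (ltW (T1 m z)) andbT.
  by rewrite invf_le1// lerDl.
- move=> z p q pq; rewrite lerD2l lerN2 lef_pV2 ?posrE//.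
  by rewrite lerD2l; exact: T_nd.
- move=> z; rewrite {1}UE => -[k _ zk].
  have Bk : 0 < bump2 (a k) (r k) z.
    by case: zk => z1 z2; rewrite mulr_gt0// ball_bump_gt0.
  rewrite -[X in _ --> X]subr0; apply: cvgB; first exact: cvg_cst.
  apply/cvgr0Pnorm_le => e e0.
  near=> m; rewrite ger0_norm ?invr_ge0 ?(ltW (T1 _ _))//.
  rewrite invf_ple ?posrE//; apply: (@le_trans _ _ (T m z)); last by rewrite lerDr.
  apply: (@le_trans _ _ (m%:R * bump2 (a k) (r k) z)); last first.
    rewrite ler_wpM2l//.
    apply: (@le_trans _ _ (S k.+1 z)).
      by rewrite /S big_ord_recr/= lerDr sumr_ge0.
    by apply: S_nd; near: m; exact: nbhs_infty_gt.
  by rewrite -ler_pdivrMr//; near: m; exact: nbhs_infty_ger.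
Unshelve. all: by end_near. Qed.

End cutoffs.

(** * The fundamental lemma of the calculus of variations *)

Section compactly_supported_C1.
Context {R : realType} {W : normedModType R}.
Implicit Types (U : set W) (f : W -> R).

Lemma zero_off_support f x : ~ closure [set x | f x != 0] x -> f x = 0.
Proof.
by move=> nx; apply/eqP; apply: contra_notT nx => fx; exact: subset_closure.
Qed.

Lemma Ck_c1_setT U f : Ck_c 1 U f -> is_Ck 1 setT f.
Proof.
move=> [Cf [_ sU]].
exact: (is_Ck1_setT (@closed_closure _ _) (@zero_off_support f) sU Cf).
Qed.

Lemma Ck_c1_subset U U' f : U `<=` U' -> Ck_c 1 U f -> Ck_c 1 U' f.
Proof.
move=> UU' Cf; split.
  by apply: (is_Ck_subset (@subsetT _ _)); exact: Ck_c1_setT Cf.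
by case: Cf => _ [cs sU]; split => //; exact: subset_trans sU UU'.
Qed.

End compactly_supported_C1.

Section vanishing_integrals.
Context {R : realType} {n : nat}.
Local Notation V := 'rV[R]_n.
Local Notation leb2 := (@lebesgue_rV R n \x @lebesgue_rV R n)%E.

(** The sets on which the integral vanishes form a Dynkin system, and the open
    sets are a pi-system that generates the sigma-algebra. *)
Lemma ae_zero_of_open_integrals (B : set (V * V)) (h : V * V -> R) : open B ->
  leb2.-integrable B (EFin \o h) ->
  (forall W, open W -> W `<=` B -> (\int[leb2]_(z in W) (h z)%:E = 0)%E) ->
  {ae leb2, forall z, B z -> h z = 0}.
Proof.
move=> oB ih h0.
have mB := open_measurable_rV2 oB.
have iS A : measurable A -> leb2.-integrable (B `&` A) (EFin \o h).
  by move=> mA; apply: (integrableS mB) => //; exact: measurableI.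
have key A : measurable A -> (\int[leb2]_(z in B `&` A) (h z)%:E = 0)%E.
  rewrite [in X in X -> _]measurable_rV2_gen_open.
  apply: (dynkin_induction (P := fun A => (\int[leb2]_(z in B `&` A) (h z)%:E = 0)%E)
    measurable_rV2_gen_open).
  - by move=> U W oU oW; exact: openI.
  - by rewrite setIT h0.
  - by move=> W oW; rewrite h0//; exact: openI.
  - move=> A0 mA A00.
    have : (\int[leb2]_(z in B) (h z)%:E = 0)%E by rewrite h0.
    rewrite -{1}(setIT B) -(setUv A0) setIUr integral_setU.
    + by rewrite A00 add0e.
    + exact: measurableI.
    + by apply: measurableI => //; exact: measurableC.
    + rewrite -setIUr setUv setIT; exact: measurable_int ih.
    + by rewrite disj_set2E setIACA setICr setI0.
  - move=> F mF tF F0; rewrite setI_bigcupr integral_bigcup.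
    + by apply: eseries0 => i _ _; exact: F0.
    + by apply: trivIset_setIl.
    + by move=> k; exact: measurableI.
    + by rewrite -setI_bigcupr; apply: iS; exact: bigcupT_measurable.
have : ae_eq leb2 B (EFin \o h) (cst 0%E).
  apply: integral_ae_eq => // E EB mE.
  by rewrite integral_cst// mul0e -(setIidr EB); exact: key.
by apply: filterS => z /[apply] -[].
Qed.

(** The integrals of [h] over open sets are limits of integrals of [h] against
    cutoff functions. *)
Lemma ae_zero_of_test_functions (U : set (V * V)) (h : V * V -> R) : open U ->
  (forall K, compact K -> K `<=` U -> leb2.-integrable K (EFin \o h)) ->
  (forall psi, Ck_c 1 U psi -> (\int[leb2]_(z in U) (h z * psi z)%:E = 0)%E) ->
  {ae leb2, forall z, U z -> h z = 0}.
Proof.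
move=> oU ih h0; have [a [r [arU UE]]] := open_bigcup_ball oU.
suff : forall k, {ae leb2, forall z, ball (a k) (r k) z -> h z = 0}.
  move=> /ae_foralln; apply: filterS => z hz; rewrite UE => -[k _].
  exact: hz.
move=> k; have [r0|r0] := ltP 0 (r k); last first.
  apply: aeW => z [/rV_ballP[]]; by rewrite ltNge r0.
have oB : open (ball (a k) (r k)) by exact: ball_open.
have KU : closed_ball (a k).1 (r k) `*` closed_ball (a k).2 (r k) `<=` U.
  move=> z [z1 z2]; apply: (arU k).
  by split; apply: closed_ball_sub_ball; [|exact: z1| |exact: z2]; rewrite mulr2n ltrDl.
have iB : leb2.-integrable (ball (a k) (r k)) (EFin \o h).
  have cK : compact (closed_ball (a k).1 (r k) `*` closed_ball (a k).2 (r k)).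
    by apply: compact_setX; exact: compact_closed_ball.
  apply: (integrableS (compact_measurable_rV2 cK)); last exact: ih.
  - exact: open_measurable_rV2.
  - by move=> z [z1 z2]; split; exact: subset_closed_ball.
apply: ae_zero_of_open_integrals => // W oW WB.
have [chi [Cchi chi01 _ chi1]] := exists_cutoffs oW.
have mW := open_measurable_rV2 oW.
have iW : leb2.-integrable W (EFin \o h).
  by apply: (integrableS (open_measurable_rV2 oB)).
have mh : measurable_fun W h by have /measurable_int/measurable_EFinP := iW.
have WU : W `<=` U.
  by apply: subset_trans WB _ => z [z1 z2]; apply: KU; split; exact: subset_closed_ball.
have mchi m : measurable_fun W (chi m).
  apply: (open_continuous_measurable_rV2 oW) => z Wz.
  by case: (Cchi m) => -[d _] _; exact: (differentiable_continuous (d _ Wz)).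
have chi_out m z : ~ W z -> chi m z = 0.
  move=> nW; apply: zero_off_support => cz; apply: nW.
  by case: (Cchi m) => _ [_]; exact.
have z0 m : (\int[leb2]_(z in W) (h z * chi m z)%:E = 0)%E.
  rewrite -[RHS](h0 (chi m)); last first.
    exact: Ck_c1_subset WU (Cchi m).
  rewrite [LHS]integral_mkcond [RHS]integral_mkcond; apply: eq_integral => z _.
  rewrite !patchE; have [Wz|nWz] := pselect (W z).
    by rewrite !mem_set//; exact: WU.
  by rewrite (memNset nWz); case: ifPn => // _; rewrite chi_out ?mulr0.
have [] := @dominated_convergence _ _ _ leb2 W mW (fun m z => (h z * chi m z)%:E)
  (EFin \o h) (abse \o (EFin \o h)).
- by move=> m; apply/measurable_EFinP; exact: measurable_funM.
- exact/measurable_EFinP.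
- apply: aeW => z Wz; apply/fine_cvgP; split; first by apply: nearW.
  rewrite -[X in _ --> X]mulr1; apply: cvgM; [exact: cvg_cst|exact: chi1].
- exact: integrable_abse.
- apply: aeW => z m Wz; rewrite /= lee_fin normrM ler_piMr//.
  by have /andP[c0 c1] := chi01 m z; rewrite ger0_norm.
move=> _ _; under eq_fun do rewrite z0; move=> /cvg_lim => <-//.
by rewrite lim_cst.
Qed.

End vanishing_integrals.

(** * Uniqueness of the weak nonlocal gradient *)

Section weak_gradient.
Context {R : realType} {n : nat}.
Local Notation V := 'rV[R]_n.
Local Notation leb := (@lebesgue_rV R n).
Local Notation leb2 := (leb \x leb)%E.
Variables (Omega : set V) (w : V * V -> R).
Hypotheses (oO : open Omega) (hw : admissible Omega w).
Variables (u : V -> R) (hu : Ck_c 1 Omega u).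

Let oOO : open (Omega `*` Omega). Proof. exact: open_setX. Qed.
Let mOO : measurable (Omega `*` Omega). Proof. exact: open_measurable_rV2. Qed.

Let Cu : is_Ck 1 setT u. Proof. exact: Ck_c1_setT hu. Qed.

Let cu : continuous u.
Proof. by move=> x; case: Cu => du _; exact: (differentiable_continuous (du x I)). Qed.

Let u0 x : ~ Omega x -> u x = 0.
Proof. by move=> nx; apply: zero_off_support => sx; apply: nx; case: hu => _ [_]; exact. Qed.

Lemma integral_nl_partial_adj_Ck_c psi i : Ck_c 1 (Omega `*` Omega) psi ->
  [/\ leb.-integrable Omega (EFin \o (fun x => u x * nl_partial_adj Omega w i psi x)),
      leb2.-integrable (Omega `*` Omega) (EFin \o (fun z => nl_grad w u i z * psi z)) &
      (\int[leb]_(x in Omega) (u x * nl_partial_adj Omega w i psi x)%:E =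
       - \int[leb2]_(z in Omega `*` Omega) (nl_grad w u i z * psi z)%:E)%E].
Proof.
move=> Cpsi; have Cp := Ck_c1_setT Cpsi; case: Cpsi => _ [cs sOO].
have p0 := @zero_off_support _ _ psi.
split.
- exact: (nl_partial_adj_integrable oO hw Cu Cp cs sOO p0).
- exact: (nl_grad_psi_integrable oO hw Cu Cp cs sOO p0).
- exact: (integral_nl_partial_adj oO hw Cu Cp cs sOO p0).
Qed.

Let cG i z : (Omega `*` Omega) z -> {for z, continuous (nl_grad w u i)}.
Proof. exact: (nl_grad_continuous hw Cu). Qed.

Lemma nl_grad_weak i : is_weak_nl_partial Omega w i u (nl_grad w u i).
Proof.
split.
- split; first by apply: (open_continuous_measurable_rV oO) => z _; exact: cu.
  by move=> K cK KO; apply: (compact_integrable_rV oO _ cK KO) => z _; exact: cu.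
- split; first exact: (open_continuous_measurable_rV2 oOO (@cG i)).
  by move=> K cK KO; exact: (compact_integrable_rV2 oOO (@cG i) cK KO).
- move=> psi /(@integral_nl_partial_adj_Ck_c psi i)[_ iG E].
  rewrite /Rintegral E fineN//.
Qed.

(** Two weak derivatives have the same integrals against all test functions. *)
Lemma weak_nl_partial_unique i g : is_weak_nl_partial Omega w i u g ->
  {ae leb2, forall z, (Omega `*` Omega) z -> g z = nl_grad w u i z}.
Proof.
move=> [_ [mg ig] gE].
have iGK K : compact K -> K `<=` Omega `*` Omega ->
    leb2.-integrable K (EFin \o nl_grad w u i).
  by move=> cK KO; exact: (compact_integrable_rV2 oOO (@cG i) cK KO).
suff : {ae leb2, forall z, (Omega `*` Omega) z -> g z - nl_grad w u i z = 0}.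
  by apply: filterS => z /[apply] /eqP; rewrite subr_eq0 => /eqP.
apply: (ae_zero_of_test_functions (h := fun z => g z - nl_grad w u i z) oOO).
  move=> K cK KO.
  rewrite (_ : EFin \o (fun z => g z - nl_grad w u i z) =
    ((EFin \o g) \- (EFin \o nl_grad w u i))%E)//.
  by apply: integrableB; [exact: compact_measurable_rV2|exact: ig|exact: iGK].
move=> psi Cpsi.
have [_ iG EG] := integral_nl_partial_adj_Ck_c i Cpsi.
have igpsi : leb2.-integrable (Omega `*` Omega) (EFin \o (fun z => g z * psi z)).
  have Cp := Ck_c1_setT Cpsi; case: Cpsi => _ [cs sOO].
  have cp z : {for z, continuous psi}.
    by case: Cp => d _; exact: (differentiable_continuous (d z I)).
  have mK := compact_measurable_rV2 cs.
  apply: (integrable_of_support mK mOO sOO); last first.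
    by move=> z /zero_off_support ->; rewrite mulr0.
  rewrite (_ : EFin \o (fun z => g z * psi z) = ((EFin \o psi) \* (EFin \o g))%E); last first.
    by apply/funext => z /=; rewrite mulrC.
  apply: (integrableMr mK) => //; last exact: ig.
    apply: measurable_funTS.
    by apply: (open_continuous_measurable_rV2 openT) => z _; exact: cp.
  have [M M0 hM] := continuous_compact_bounded cs (fun z _ => cp z).
  exists M; split; first exact: num_real.
  by move=> x Mx z Kz; apply: le_trans (hM _ Kz) (ltW Mx).
have EE : (\int[leb2]_(z in Omega `*` Omega) (g z * psi z)%:E =
           \int[leb2]_(z in Omega `*` Omega) (nl_grad w u i z * psi z)%:E)%E.
  have := gE _ Cpsi; rewrite /Rintegral EG fineN => /oppr_inj E.
  rewrite -[LHS]fineK; last exact: integrable_fin_num.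
  by rewrite -E fineK//; exact: integrable_fin_num.
transitivity (\int[leb2]_(z in Omega `*` Omega)
    ((g z * psi z)%:E - (nl_grad w u i z * psi z)%:E))%E.
  by apply: eq_integral => z _; rewrite mulrBl EFinB.
by rewrite (integralB mOO igpsi iG) EE subee//; exact: integrable_fin_num.
Qed.

End weak_gradient.

Section integrals_over_products.
Context {R : realType} {n : nat}.
Local Notation V := 'rV[R]_n.
Local Notation leb := (@lebesgue_rV R n).
Local Notation leb2 := (leb \x leb)%E.
Local Open Scope ereal_scope.

(** Tonelli's theorem for integrals over subsets, which are integrals of
    extensions by zero. *)
Lemma tonelli_setX (A B : set V) (f : V * V -> \bar R) : measurable A -> measurable B ->
  measurable_fun (A `*` B) f -> (forall z, 0 <= f z) ->
  \int[leb]_(x in A) \int[leb]_(y in B) f (x, y) = \int[leb2]_(z in A `*` B) f z.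
Proof.
move=> mA mB mf f0.
have mfr : measurable_fun setT (f \_ (A `*` B)).
  exact/(measurable_restrictT _ (measurableX mA mB)).
have fr0 z : 0 <= (f \_ (A `*` B)) z by apply: erestrict_ge0 => ? _.
rewrite [RHS]integral_mkcond (fubini_tonelli1 _ mfr fr0).
rewrite integral_mkcond; apply: eq_integral => x _; rewrite /fubini_F patchE.
have [Ax|nAx] := pselect (A x).
  rewrite mem_set// [LHS]integral_mkcond; apply: eq_integral => y _; rewrite !patchE.
  have [By|nBy] := pselect (B y); first by rewrite !mem_set.
  by rewrite (memNset nBy) memNset// => -[].
rewrite memNset//; apply/esym/integral0_eq => y _; rewrite patchE memNset//.
by move=> [/= /nAx].
Qed.

Lemma ge0_integral_swap (f : V * V -> \bar R) : measurable_fun setT f ->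
  (forall z, 0 <= f z) -> \int[leb2]_z f (swap z) = \int[leb2]_z f z.
Proof.
move=> mf f0.
have ms : measurable_fun setT (fun z : V * V => f (swap z)).
  apply: (measurableT_comp mf).
  by apply: measurable_fun_pair; [exact: measurable_snd|exact: measurable_fst].
by rewrite (fubini_tonelli1 _ ms (fun z => f0 _)) [RHS](fubini_tonelli2 _ mf f0).
Qed.

End integrals_over_products.

Lemma finite_normP d (T : measurableType d) (R : realType)
    (mu : {measure set T -> \bar R}) (p : R) (f : T -> R) : 0 < p ->
  finite_norm mu p%:E f <-> (\int[mu]_x (`|f x| `^ p)%:E < +oo)%E.
Proof.
move=> p0; rewrite /finite_norm unlock /=.
rewrite [X in (X `^ _)%E](_ : _ = \int[mu]_x (`|f x| `^ p)%:E)%E//.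
have I0 : (0 <= \int[mu]_x (`|f x| `^ p)%:E)%E.
  by apply: integral_ge0 => x _; rewrite lee_fin powR_ge0.
split => [|h]; last by rewrite poweR_lty.
move: I0; case: (\int[mu]_x _)%E => [r||]// _ h; first by rewrite ltry.
by move: h; rewrite poweRyr ?invr_neq0 ?gt_eqF.
Qed.

(** * Sufficiency of the conditions on the weight *)

Section euclidean_norm.
Context {R : realType} {n : nat}.
Implicit Types a : 'I_n -> R.

Lemma euclid_ge0 a : 0 <= euclid a. Proof. exact: sqrtr_ge0. Qed.

Lemma euclid0 : euclid (fun _ : 'I_n => 0 : R) = 0.
Proof. by rewrite /euclid big1 ?sqrtr0// => i _; rewrite expr0n. Qed.

Lemma le_euclid a i : `|a i| <= euclid a.
Proof.
rewrite /euclid -sqrtr_sqr ler_wsqrtr// (bigD1 i)//= lerDl.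
by apply: sumr_ge0 => j _; exact: sqr_ge0.
Qed.

Lemma euclid_le a c : 0 <= c -> (forall i, `|a i| <= c) ->
  euclid a <= Num.sqrt n%:R * c.
Proof.
move=> c0 ac; rewrite -[X in _ * X](ger0_norm c0) -(sqrtr_sqr c) -sqrtrM//.
rewrite /euclid ler_wsqrtr// mulr_natl -[X in _ *+ X](card_ord n) -sumr_const.
by apply: ler_sum => i _; rewrite -real_normK ?num_real// lerXn2r ?nnegrE.
Qed.

Lemma euclid_single (b : R) j : euclid (fun i : 'I_n => if i == j then b else 0) = `|b|.
Proof.
rewrite /euclid (bigD1 j)//= eqxx big1 ?addr0 ?sqrtr_sqr// => i /negPf ->.
by rewrite expr0n.
Qed.

Lemma measurable_euclid d (T : measurableType d) (D : set T) (g : 'I_n -> T -> R) :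
  (forall i, measurable_fun D (g i)) -> measurable_fun D (fun z => euclid (g ^~ z)).
Proof.
move=> mg; apply: (measurableT_comp (f := @Num.sqrt R)).
  by apply: continuous_measurable_fun; exact: sqrt_continuous.
by apply: measurable_sum => i; exact: measurable_funX.
Qed.

End euclidean_norm.

Lemma finite_norm_bounded d (T : measurableType d) (R : realType)
    (mu : {measure set T -> \bar R}) (f : T -> R) M :
  (forall x, `|f x| <= M) -> finite_norm mu +oo%E f.
Proof.
move=> fM; rewrite /finite_norm unlock; case: ifPn => // _.
apply: (@le_lt_trans _ _ M%:E); last exact: ltry.
by apply: (@ess_sup_ler _ _ _ mu (fun x => `|f x|)) => x; rewrite lee_fin; exact: fM.
Qed.

Lemma finite_norm_compact_support (R : realType) n (K : set 'rV[R]_n)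
    (f : 'rV[R]_n -> R) p : 0 < p ->
  compact K -> continuous f -> (forall x, ~ K x -> f x = 0) ->
  finite_norm (@lebesgue_rV R n) p%:E f.
Proof.
move=> p0 cK cf f0; apply/(finite_normP _ _ p0).
have [M M0 fM] := continuous_compact_bounded cK (fun z _ => cf z).
have mK := compact_measurable_rV cK.
have : (@lebesgue_rV R n).-integrable setT (EFin \o (fun x => `|f x| `^ p)).
  apply: (integrable_of_support mK measurableT) => //.
    apply: (bounded_integrable (M := M `^ p) mK).
    - exact: lebesgue_rV_compact_fin.
    - apply: measurable_funTS; apply: (measurableT_comp (measurable_powR p)).
      apply: measurableT_comp => //.
      by apply: (open_continuous_measurable_rV openT) => z _; exact: cf.
    - move=> z Kz; rewrite ger0_norm ?powR_ge0//.
      apply: ge0_ler_powR; rewrite ?nnegrE ?(ltW p0) ?(ltW M0)//; exact: fM.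
  by move=> z /f0 ->; rewrite normr0 powR0// gt_eqF.
move=> /integrableP[_]; congr (_ < _)%E; apply: eq_integral => x _.
by rewrite /= ger0_norm ?powR_ge0.
Qed.

Section sufficient_conditions.
Context {R : realType} {n : nat}.
Local Notation V := 'rV[R]_n.
Local Notation leb := (@lebesgue_rV R n).
Local Notation leb2 := (leb \x leb)%E.
Variables (Omega : set V) (w : V * V -> R).
Hypotheses (oO : open Omega) (hw : admissible Omega w).

Let oOO : open (Omega `*` Omega). Proof. exact: open_setX. Qed.
Let mOO : measurable (Omega `*` Omega). Proof. exact: open_measurable_rV2. Qed.

Lemma admissible_ge0 z : (Omega `*` Omega) z -> 0 <= w z.
Proof. by case: z => x y [Ox Oy]; case: hw => _ + _; exact. Qed.

Lemma admissible_swap z : (Omega `*` Omega) z -> w (swap z) = w z.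
Proof. by case: z => x y [Ox Oy]; case: hw => _ _; exact. Qed.

Lemma measurable_admissible_powR p : measurable_fun (Omega `*` Omega) (fun z => w z `^ p).
Proof.
apply: (measurableT_comp (measurable_powR p)).
by apply: (open_continuous_measurable_rV2 oOO) => z; exact: admissible_continuous.
Qed.

(** As a single integral over the product the condition can be reflected by
    the exchange of the two variables. *)
Lemma cond_AE p (K : set V) : measurable K -> K `<=` Omega ->
  cond_A Omega w p K <-> (\int[leb2]_(z in K `*` Omega) (w z `^ p)%:E < +oo)%E.
Proof.
move=> mK KO; have mO := open_measurable_rV oO; rewrite /cond_A.
rewrite -(tonelli_setX (f := fun z => (w z `^ p)%:E) mK mO)//.
- apply/measurable_EFinP; apply: measurable_funS (measurable_admissible_powR p) => //.
  by move=> z [z1 z2]; split => //; exact: KO.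
- by move=> z; rewrite lee_fin powR_ge0.
Qed.

Variables (u : V -> R) (K : set V).
Hypotheses (hu : Ck_c 1 Omega u) (cK : compact K) (KO : K `<=` Omega).
Hypothesis supp_u : closure [set x | u x != 0] `<=` K.

Let Cu : is_Ck 1 setT u. Proof. exact: Ck_c1_setT hu. Qed.

Let cu : continuous u.
Proof. by move=> x; case: Cu => du _; exact: (differentiable_continuous (du x I)). Qed.

Let u0 x : ~ K x -> u x = 0.
Proof. by move=> nx; apply: zero_off_support => /supp_u. Qed.

Let Du0 i x : ~ K x -> 'D_(delta_mx ord0 i) u x = 0.
Proof.
by move=> nx; apply: (derive_zero_off (@closed_closure _ _) (@zero_off_support _ _ u)) => /supp_u.
Qed.

Lemma gradient_bounded :
  exists2 M, 0 < M & forall i x, `|'D_(delta_mx ord0 i) u x| <= M.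
Proof.
have h i : exists M, forall x, `|'D_(delta_mx ord0 i) u x| <= M.
  have [M M0 hM] := continuous_compact_bounded (f := fun x => 'D_(delta_mx ord0 i) u x)
    cK (fun x _ => proj2 Cu (delta_mx ord0 i) x I).
  exists M => x; have [/hM//|/(Du0 i) ->] := pselect (K x); by rewrite normr0 ltW.
have [M hM] := choice h; have M_ge0 i : 0 <= M i by exact: le_trans (hM i 0).
exists (1 + \sum_i M i); first by rewrite ltr_pwDl// sumr_ge0.
move=> i x; apply: le_trans (hM i x) _.
by rewrite (bigD1 i)//= addrCA lerDl addr_ge0// sumr_ge0.
Qed.

Let grad z := euclid (fun i => nl_grad w u i z).

Lemma nl_grad_norm_le : exists2 C, 0 < C &
  forall z, (Omega `*` Omega) z -> grad z <= C * w z.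
Proof.
have [M M0 hM] := gradient_bounded.
exists (Num.sqrt n%:R * (M + M) + 1).
  by rewrite ltr_wpDl// mulr_ge0 ?sqrtr_ge0 ?addr_ge0 ?(ltW M0).
move=> z Oz; have w0 := admissible_ge0 Oz.
rewrite mulrDl mul1r; apply: ler_wpDr => //; rewrite -mulrA.
apply: euclid_le; first by rewrite mulr_ge0 ?addr_ge0 ?(ltW M0).
move=> i; rewrite normrM (ger0_norm w0) mulrC ler_wpM2r//.
by apply: le_trans (ler_normB _ _) _; apply: lerD; exact: hM.
Qed.

Lemma nl_grad_norm_eq0 z : ~ K z.1 -> ~ K z.2 -> grad z = 0.
Proof.
move=> n1 n2; rewrite /grad -[RHS](@euclid0 R n); congr euclid.
by apply/funext => i; rewrite /nl_grad !Du0 ?subrr ?mulr0.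
Qed.

Let mgrad : measurable_fun (Omega `*` Omega) grad.
Proof.
apply: measurable_euclid => i.
by apply: (open_continuous_measurable_rV2 oOO) => z; exact: (nl_grad_continuous hw Cu).
Qed.

Let u_patch : u \_ Omega = u.
Proof.
apply/funext => x; rewrite patchE; case: ifPn => // /negP nx.
by rewrite u0// => /KO Ox; apply: nx; rewrite inE.
Qed.

Let measurable_u : measurable_fun Omega u.
Proof. by apply: (open_continuous_measurable_rV oO) => x _; exact: cu. Qed.

Lemma Lp_of_compact_support p : 0 < p -> Lp leb Omega p%:E u.
Proof.
move=> p0; split => //; rewrite u_patch.
exact: (finite_norm_compact_support p0 cK cu).
Qed.

(** The gradient vanishes unless one of the two points lies in [K]: its norm is
    at most [C * w], extended by zero off [K `*` Omega] and off its mirror image,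
    over which the weight has the same integral by symmetry. *)
Lemma nl_grad_Lp p : 0 < p -> cond_A Omega w p K ->
  Lp leb2 (Omega `*` Omega) p%:E grad.
Proof.
move=> p0 /(cond_AE _ (compact_measurable_rV cK) KO) AK.
split => //; apply/(finite_normP _ _ p0).
have mKO : measurable (K `*` Omega).
  by apply: measurableX; [exact: compact_measurable_rV|exact: open_measurable_rV].
have KOO : K `*` Omega `<=` Omega `*` Omega by move=> z [/KO z1 z2].
pose f := (fun z => (w z `^ p)%:E) \_ (K `*` Omega).
have f0 z : (0 <= f z)%E by apply: erestrict_ge0 => ? _; rewrite lee_fin powR_ge0.
have mf : measurable_fun setT f.
  apply/(measurable_restrictT _ mKO)/measurable_EFinP.
  exact: measurable_funS (measurable_admissible_powR p).
have mfs : measurable_fun setT (f \o @swap R V).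
  apply: (measurableT_comp mf).
  by apply: measurable_fun_pair; [exact: measurable_snd|exact: measurable_fst].
have [C C0 hC] := nl_grad_norm_le.
apply: (@le_lt_trans _ _ (\int[leb2]_z ((C `^ p)%:E * (f z + f (swap z))))%E).
  apply: ge0_le_integral => //.
  - apply/measurable_EFinP; apply: (measurableT_comp (measurable_powR p)).
    apply: measurableT_comp => //; exact/(measurable_restrictT _ mOO).
  - by apply: measurable_funeM; exact: emeasurable_funD.
  - move=> z _; rewrite patchE.
    have [Oz|nOz] := pselect ((Omega `*` Omega) z); last first.
      rewrite memNset// normr0 powR0 ?gt_eqF// mule_ge0 ?adde_ge0//.
      by rewrite lee_fin powR_ge0.
    have w0 := admissible_ge0 Oz; have sOz : (Omega `*` Omega) (swap z) by case: Oz.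
    rewrite mem_set//.
    have gle : ((`|grad z| `^ p)%:E <= (C `^ p)%:E * (w z `^ p)%:E)%E.
      rewrite -EFinM -powRM ?(ltW C0)// lee_fin ger0_norm ?euclid_ge0//.
      by apply: ge0_ler_powR; rewrite ?nnegrE ?euclid_ge0 ?(ltW p0) ?mulr_ge0 ?(ltW C0)//; exact: hC.
    have [K1|nK1] := pselect (K z.1).
      apply: le_trans gle _; rewrite lee_wpmul2l ?lee_fin ?powR_ge0//.
      rewrite [in f z]/f patchE mem_set ?leeDl//.
      by split => //; case: Oz.
    have [K2|nK2] := pselect (K z.2).
      apply: le_trans gle _; rewrite lee_wpmul2l ?lee_fin ?powR_ge0//.
      rewrite [in f (swap z)]/f patchE mem_set ?admissible_swap ?leeDr//.
      by split => //; case: Oz.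
    rewrite nl_grad_norm_eq0// normr0 powR0 ?gt_eqF// mule_ge0 ?adde_ge0//.
    by rewrite lee_fin powR_ge0.
rewrite ge0_integralZl_EFin ?powR_ge0//; last 2 first.
- by move=> z _; rewrite adde_ge0.
- exact: emeasurable_funD.
rewrite ge0_integralD// (ge0_integral_swap mf f0) /f -integral_mkcond.
by rewrite lte_mul_pinfty ?lee_fin ?powR_ge0// lte_add_pinfty.
Qed.

Lemma W1_of_cond_A p : 0 < p -> cond_A Omega w p K -> W1 Omega w p%:E u.
Proof.
move=> p0 AK; split; first exact: Lp_of_compact_support.
exists (nl_grad w u); split; last exact: nl_grad_Lp.
by move=> i; exact: nl_grad_weak.
Qed.

Lemma W1_of_cond_Aoo : cond_Aoo Omega w K -> W1 Omega w +oo%E u.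
Proof.
move=> AK; split.
  split => //; rewrite u_patch.
  have [M M0 hM] := continuous_compact_bounded cK (fun z _ => @cu z).
  apply: (finite_norm_bounded _ (M := M)) => x.
  by have [/hM//|/u0 ->] := pselect (K x); rewrite normr0 ltW.
exists (nl_grad w u); split; first by move=> i; exact: nl_grad_weak.
split => //.
have [M M0 hM] : exists2 M, 0 <= M & forall z, (K `*` Omega) z -> w z <= M.
  exists `|fine (ereal_sup [set (w z)%:E | z in K `*` Omega])| => // z Kz.
  have wle : ((w z)%:E <= ereal_sup [set (w z)%:E | z in K `*` Omega])%E.
    by apply: ereal_sup_ubound; exists z.
  move: wle AK; rewrite /cond_Aoo; case: (ereal_sup _) => [r| |]//=.
  by rewrite lee_fin => wr _; rewrite (le_trans wr)// ler_norm.
have [C C0 hC] := nl_grad_norm_le.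
apply: (finite_norm_bounded _ (M := C * M)) => z; rewrite patchE.
have CM0 : 0 <= C * M by rewrite mulr_ge0// ltW.
have [Oz|nOz] := pselect ((Omega `*` Omega) z); last by rewrite memNset// normr0.
rewrite mem_set// ger0_norm ?euclid_ge0//.
have [K1|nK1] := pselect (K z.1).
  apply: le_trans (hC _ Oz) _; rewrite ler_wpM2l ?(ltW C0)//.
  by apply: hM; split => //; case: Oz.
have [K2|nK2] := pselect (K z.2).
  apply: le_trans (hC _ Oz) _; rewrite ler_wpM2l ?(ltW C0)// -admissible_swap//.
  by apply: hM; split => //; case: Oz.
by rewrite [X in X <= _]nl_grad_norm_eq0.
Qed.

Lemma integral_nl_div (phi : 'I_n -> V * V -> R) :
  (forall i, Ck_c 1 (Omega `*` Omega) (phi i)) ->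
  (\int[leb]_(x in Omega) (u x * nl_div Omega w phi x)%:E =
   - \sum_(i < n) \int[leb2]_(z in Omega `*` Omega) (nl_grad w u i z * phi i z)%:E)%E.
Proof.
move=> Cphi; have mO := open_measurable_rV oO.
have H i := integral_nl_partial_adj_Ck_c oO hw hu i (Cphi i).
transitivity (\int[leb]_(x in Omega)
    (\sum_(i < n) (u x * nl_partial_adj Omega w i (phi i) x)%:E))%E.
  by apply: eq_integral => x _; rewrite /nl_div mulr_sumr sumEFin.
rewrite integral_sum//; last by move=> i; have [] := H i.
rewrite -sumeN; last first.
  move=> i j _ _; apply/fin_num_adde_defl/integrable_fin_num => //.
  by have [] := H j.
by apply: eq_bigr => i _; have [_ _ ->] := H i.
Qed.

(** The components of a test field of norm at most one are at most one, hence
    the variation is at most the sum of the L^1 norms of the components of the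
    nonlocal gradient. *)
Lemma NLBV_of_cond_A : cond_A Omega w 1 K -> NLBV Omega w u.
Proof.
move=> AK; split; first exact: Lp_of_compact_support.
have mG i : measurable_fun (Omega `*` Omega) (nl_grad w u i).
  by apply: (open_continuous_measurable_rV2 oOO) => z; exact: (nl_grad_continuous hw Cu).
have iG i : (\int[leb2]_(z in Omega `*` Omega) `|nl_grad w u i z|%:E < +oo)%E.
  have [_ /(finite_normP _ _ ltr01)] := nl_grad_Lp ltr01 AK.
  apply: le_lt_trans; rewrite [leLHS]integral_mkcond; apply: ge0_le_integral => //.
  - by move=> z _; apply: erestrict_ge0 => ? _; rewrite lee_fin.
  - apply/(measurable_restrictT _ mOO)/measurable_EFinP; exact: measurableT_comp.
  - apply/measurable_EFinP; apply: (measurableT_comp (measurable_powR 1)).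
    apply: measurableT_comp => //; exact/(measurable_restrictT _ mOO).
  - move=> z _; rewrite powRr1// !patchE; case: ifPn => _; last by rewrite normr0.
    by rewrite lee_fin (ger0_norm (euclid_ge0 _)) le_euclid.
apply: (@le_lt_trans _ _ (\sum_(i < n)
    \int[leb2]_(z in Omega `*` Omega) `|nl_grad w u i z|%:E)%E); last first.
  by apply/lte_sum_pinfty => i _; exact: iG.
apply: ge_ereal_sup => _ [phi [Cphi phi1] <-].
rewrite integral_nl_div// -sumeN; last first.
  move=> i j _ _; apply/fin_num_adde_defl/integrable_fin_num => //.
  by have [] := integral_nl_partial_adj_Ck_c oO hw hu j (Cphi j).
apply: lee_sum => i _.
have [_ iGp _] := integral_nl_partial_adj_Ck_c oO hw hu i (Cphi i).
apply: le_trans (lee_abs _) _; rewrite abseN.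
apply: le_trans (le_abse_integral _ mOO (measurable_int _ iGp)) _.
apply: ge0_le_integral => //.
- by have /integrable_abse/measurable_int := iGp.
- by apply/measurable_EFinP; exact: measurableT_comp.
- move=> z _; rewrite lee_fin normrM ler_piMr//.
  exact: le_trans (le_euclid (fun i => phi i z) i) (phi1 z).
Qed.

End sufficient_conditions.

(** * Necessity of the conditions on the weight *)

(** By continuity a violation of the bound would extend to a ball, which has
    positive measure. *)
Lemma open_ae_everywhere (R : realType) n (U : set ('rV[R]_n * 'rV[R]_n))
    (f : 'rV[R]_n * 'rV[R]_n -> R) (M : R) :
  open U -> (forall z, U z -> {for z, continuous f}) ->
  {ae (@lebesgue_rV R n \x @lebesgue_rV R n)%E, forall z, U z -> f z <= M} ->
  forall z, U z -> f z <= M.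
Proof.
move=> oU cf [A [mA A0 hA]] z Uz; rewrite leNgt; apply/negP => Mf.
have oP := open_preimage_gt M oU cf.
have : nbhs z (U `&` f @^-1` `]M, +oo[).
  by apply: open_nbhs_nbhs; split => //; split => //=; rewrite in_itv/= Mf.
move=> /nbhs_ballP[e/= e0 eU].
have ball_gt0 a : (0 < (@lebesgue_rV R n) (ball a e))%E.
  rewrite (_ : ball a e = [set v : 'rV[R]_n | forall i, ball (a ord0 i) e (v ord0 i)]); last first.
    by apply/seteqP; split => x /=; [move=> /rV_ballP[]|move=> h; apply/rV_ballP].
  rewrite (lebesgue_rV_box (A := fun i => ball (a ord0 i) e)) => [|i]; last first.
    exact: measurable_ball.
  under eq_bigr do rewrite lebesgue_measure_ball ?(ltW e0)//.
  by rewrite prodEFin lte_fin prodr_gt0// => i _; rewrite pmulrn_lgt0.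
have : ((@lebesgue_rV R n \x @lebesgue_rV R n)%E (ball z e) <= 0)%E.
  rewrite -A0; apply: le_measure; rewrite ?inE//; first exact: measurable_ball_rV2.
  move=> y /eU[Uy /=]; rewrite in_itv/= andbT => My; apply: hA => /= /(_ Uy).
  by rewrite leNgt My.
rewrite (_ : ball z e = ball z.1 e `*` ball z.2 e)//.
rewrite product_measure1E; try exact: measurable_ball_rV.
move=> h; have := lt_le_trans (mule_gt0 (ball_gt0 z.1) (ball_gt0 z.2)) h.
by rewrite ltxx.
Qed.

Section necessary_conditions.
Context {R : realType} {n : nat}.
Local Notation V := 'rV[R]_n.
Local Notation leb := (@lebesgue_rV R n).
Local Notation leb2 := (leb \x leb)%E.
Variables (Omega : set V) (w : V * V -> R).
Hypotheses (oO : open Omega) (hw : admissible Omega w).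
Variables (u : V -> R) (hu : Ck_c 1 Omega u).
Variables (i : 'I_n) (x0 : V).
Hypotheses (Ox0 : Omega x0) (Du : 'D_(delta_mx ord0 i) u x0 != 0).

Let S := closure [set x | u x != 0].
Let Di x := 'D_(delta_mx ord0 i) u x.
Let far := Omega `&` ~` S.

Let Cu : is_Ck 1 setT u. Proof. exact: Ck_c1_setT hu. Qed.
Let cS : compact S. Proof. by case: hu => _ []. Qed.
Let SO : S `<=` Omega. Proof. by case: hu => _ []. Qed.
Let ofar : open far.
Proof. by apply: openI => //; apply: closed_openC; exact: closed_closure. Qed.

Let oOO : open (Omega `*` Omega). Proof. exact: open_setX. Qed.
Let mOO : measurable (Omega `*` Omega). Proof. exact: open_measurable_rV2. Qed.

(** By continuity the partial derivative keeps, near [x0], its sign and at least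
    half of its absolute value. *)
Lemma derivative_away_from0 : exists r s c : R,
  [/\ 0 < r, `|s| = 1, 0 < c, ball x0 (r *+ 2) `<=` Omega &
    forall x, ball x0 (r *+ 2) x -> c <= s * Di x].
Proof.
pose s := Num.sg (Di x0); pose c := `|Di x0| / 2.
have D0 : 0 < `|Di x0| by rewrite normr_gt0.
have c0 : 0 < c by rewrite divr_gt0.
have cD : {for x0, continuous (fun x => s * Di x)}.
  have cs : {for x0, continuous (fun _ : V => s)} by apply: cst_continuous.
  exact: (cvgM cs (proj2 Cu (delta_mx ord0 i) x0 I)).
have : \forall x \near x0, Omega x /\ c < s * Di x.
  apply: filterI; first exact: open_nbhs_nbhs.
  have : \forall y \near s * Di x0, c < y.
    by apply: lt_nbhsr; rewrite -normrEsg /c ltr_pdivrMr// ltr_pMr// ltr1n.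
  by move=> /cD.
move=> /nbhs_ballP[e /= e0 he]; exists (e / 2), s, c.
have e2 : (e / 2) *+ 2 = e by rewrite -[_ *+ 2]mulr_natr divfK.
split => //; first by rewrite divr_gt0.
- by rewrite normr_sg Du.
- by move=> x; rewrite e2 => /he[].
- by move=> x; rewrite e2 => /he[_ /ltW].
Qed.

Section localized.
Variables (r s c : R).
Hypotheses (r0 : 0 < r) (s1 : `|s| = 1) (c0 : 0 < c).
Hypothesis rO : ball x0 (r *+ 2) `<=` Omega.
Hypothesis rc : forall x, ball x0 (r *+ 2) x -> c <= s * Di x.

Let Q := ball x0 (r *+ 2).
Let B := closed_ball x0 r.

Let BQ : B `<=` Q.
Proof. by apply: closed_ball_sub_ball; rewrite mulr2n ltrDl. Qed.

Let BO : B `<=` Omega. Proof. exact: subset_trans BQ rO. Qed.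

Let cB : compact B. Proof. exact: compact_closed_ball. Qed.

Let oQfar : open (Q `*` far). Proof. by apply: open_setX => //; exact: ball_open. Qed.
Let mQfar : measurable (Q `*` far). Proof. exact: open_measurable_rV2. Qed.
Let QfarO : Q `*` far `<=` Omega `*` Omega.
Proof. by move=> z [/rO z1 [z2 _]]. Qed.

Let BOsub : B `*` Omega `<=` (B `*` S) `|` (Q `*` far).
Proof.
move=> z [z1 z2]; have [Sz|nSz] := pselect (S z.2); first by left.
by right; split; [exact: BQ|split].
Qed.

(** Away from the support of [u] the gradient at the second point is zero, so
    the difference in the nonlocal gradient cannot cancel. *)
Lemma weight_le_nl_grad z : (Q `*` far) z ->
  c * w z <= - s * nl_grad w u i z /\ c * w z <= `|nl_grad w u i z|.
Proof.
move=> Qz; have Oz := QfarO Qz; case: Qz => z1 [z2 nS2].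
have D20 : 'D_(delta_mx ord0 i) u z.2 = 0.
  exact: (derive_zero_off (@closed_closure _ _) (@zero_off_support _ _ u)).
have w0 := admissible_ge0 hw Oz.
have E : - s * nl_grad w u i z = s * Di z.1 * w z.
  by rewrite /nl_grad D20 sub0r -/(Di z.1); ring.
have le1 : c * w z <= - s * nl_grad w u i z by rewrite E ler_wpM2r// rc.
split => //; apply: le_trans le1 _; apply: le_trans (ler_norm _) _.
by rewrite normrM normrN s1 mul1r.
Qed.

Let wBS : exists2 M, 0 < M & forall z, (B `*` S) z -> w z <= M.
Proof.
have cBS : compact (B `*` S) by exact: compact_setX.
have [z Bz|M M0 hM] := continuous_compact_bounded (f := w) cBS.
  by apply: (admissible_continuous hw); case: Bz => /BO z1 /SO.
by exists M => // z /hM; apply: le_trans; exact: ler_norm.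
Qed.

Let mB : measurable B. Proof. exact: compact_measurable_rV. Qed.
Let mS : measurable S. Proof. exact: compact_measurable_rV. Qed.
Let mO : measurable Omega. Proof. exact: open_measurable_rV. Qed.

(** On the remaining part [B `*` S] of [B `*` Omega], which is compact, the weight
    is bounded. *)
Lemma cond_A_of_far p : 0 < p ->
  (\int[leb2]_(z in Q `*` far) (w z `^ p)%:E < +oo)%E -> cond_A Omega w p B.
Proof.
move=> p0 Ifar; apply/(cond_AE oO hw _ mB BO).
have mwp A : measurable A -> A `<=` Omega `*` Omega ->
    measurable_fun setT ((fun z => (w z `^ p)%:E) \_ A).
  move=> mA AO; apply/(measurable_restrictT _ mA)/measurable_EFinP.
  exact: measurable_funS (measurable_admissible_powR oO hw p).
have wp0 A z : (0 <= ((fun z => (w z `^ p)%:E) \_ A) z)%E.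
  by apply: erestrict_ge0 => ? _; rewrite lee_fin powR_ge0.
have BSO : B `*` S `<=` Omega `*` Omega by move=> z [/BO z1 /SO z2].
have BOO : B `*` Omega `<=` Omega `*` Omega by move=> z [/BO z1 z2].
have mBS : measurable (B `*` S) by exact: measurableX.
have mBO : measurable (B `*` Omega) by exact: measurableX.
rewrite integral_mkcond.
apply: (@le_lt_trans _ _ (\int[leb2]_z (((fun z => (w z `^ p)%:E) \_ (B `*` S)) z +
    ((fun z => (w z `^ p)%:E) \_ (Q `*` far)) z))%E).
  apply: ge0_le_integral => //; [exact: mwp|by apply: emeasurable_funD; exact: mwp|].
  move=> z _; have [Bz|nBz] := pselect ((B `*` Omega) z); last first.
    by rewrite [leLHS]patchE memNset// adde_ge0.
  rewrite [leLHS]patchE mem_set//; case: (BOsub Bz) => z'.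
    by rewrite [X in (_ <= X + _)%E]patchE mem_set// leeDl.
  by rewrite [X in (_ <= _ + X)%E]patchE mem_set// leeDr.
rewrite ge0_integralD//; [|exact: mwp|exact: mwp].
rewrite -!integral_mkcond lte_add_pinfty//.
have [M M0 hM] := wBS.
have : leb2.-integrable (B `*` S) (EFin \o (fun z => w z `^ p)).
  apply: (bounded_integrable (M := M `^ p)) => //.
  - by apply: lebesgue_rV2_compact_fin; exact: compact_setX.
  - exact: measurable_funS (measurable_admissible_powR oO hw p).
  - move=> z Bz; rewrite ger0_norm ?powR_ge0//.
    apply: ge0_ler_powR; rewrite ?nnegrE ?(ltW p0) ?(ltW M0)//; last exact: hM.
    by apply: (admissible_ge0 hw); exact: BSO.
move=> /integrableP[_]; congr (_ < _)%E; apply: eq_integral => z _.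
by rewrite /= ger0_norm ?powR_ge0.
Qed.

Lemma cond_A_of_W1 p : 0 < p -> W1 Omega w p%:E u -> cond_A Omega w p B.
Proof.
move=> p0 [_ [g [hg [mg /(finite_normP _ _ p0) Lg]]]]; apply: (cond_A_of_far p0).
have ae_g := weak_nl_partial_unique oO hw hu (hg i).
rewrite integral_mkcond.
apply: (@le_lt_trans _ _ (\int[leb2]_z ((c^-1 `^ p)%:E *
   (`|((fun z => euclid (g ^~ z)) \_ (Omega `*` Omega)) z| `^ p)%:E))%E).
  have mr : measurable_fun setT (fun z =>
      (`|((fun z => euclid (g ^~ z)) \_ (Omega `*` Omega)) z| `^ p)%:E).
    apply/measurable_EFinP; apply: (measurableT_comp (measurable_powR p)).
    apply: measurableT_comp => //; exact/(measurable_restrictT _ mOO).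
  apply: ae_ge0_le_integral => //.
  - by move=> z _; apply: erestrict_ge0 => ? _; rewrite lee_fin powR_ge0.
  - apply/(measurable_restrictT _ mQfar)/measurable_EFinP.
    exact: measurable_funS (measurable_admissible_powR oO hw p).
  - by move=> z _; rewrite -EFinM lee_fin mulr_ge0 ?powR_ge0.
  - exact: measurable_funeM.
  - apply: filterS ae_g => z gz _; rewrite [leLHS]patchE.
    have [Qz|nQz] := pselect ((Q `*` far) z); last first.
      by rewrite memNset// -EFinM lee_fin mulr_ge0 ?powR_ge0.
    have Oz := QfarO Qz; rewrite mem_set// patchE mem_set// -EFinM lee_fin.
    rewrite -powRM ?invr_ge0 ?(ltW c0)//.
    have [_ h] := weight_le_nl_grad Qz; have w0 := admissible_ge0 hw Oz.
    apply: ge0_ler_powR; rewrite ?nnegrE ?(ltW p0) ?mulr_ge0 ?invr_ge0 ?(ltW c0)//.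
    rewrite mulrC ler_pdivlMr// mulrC (le_trans h)// -gz//.
    by rewrite (ger0_norm (euclid_ge0 _)); exact: (le_euclid (g ^~ z)).
rewrite ge0_integralZl_EFin ?powR_ge0//.
  by rewrite lte_mul_pinfty ?lee_fin ?powR_ge0.
apply/measurable_EFinP; apply: (measurableT_comp (measurable_powR p)).
apply: measurableT_comp => //; exact/(measurable_restrictT _ mOO).
Qed.

(** The essential bound only gives an estimate almost everywhere; the
    continuity of the weight makes it hold everywhere off the support. *)
Lemma cond_Aoo_of_W1 : W1 Omega w +oo%E u -> cond_Aoo Omega w B.
Proof.
move=> [_ [g [hg [mg Lg]]]].
have ae_g := weak_nl_partial_unique oO hw hu (hg i).
have [L hL] : exists L, {ae leb2, forall z, (Omega `*` Omega) z -> euclid (g ^~ z) <= L}.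
  move: Lg; rewrite /finite_norm unlock; case: ifPn => [_|mu0 _].
    move=> /(@ess_supr_bounded _ _ _ leb2 (fun z => `|_ z|))[L hL]; exists L.
    apply: filterS hL => z + Oz; rewrite patchE mem_set//.
    by rewrite ger0_norm ?euclid_ge0.
  exists 0, setT; split => //; apply/eqP.
  by rewrite eq_le measure_ge0 andbT leNgt.
have [M M0 hM] := wBS.
have wfar z : (Q `*` far) z -> w z <= c^-1 * L.
  apply: open_ae_everywhere => //.
    by move=> y /QfarO; exact: admissible_continuous.
  apply: filterS2 ae_g hL => y gy Ly Qy; have Oy := QfarO Qy.
  rewrite mulrC ler_pdivlMr// mulrC.
  have [_ h] := weight_le_nl_grad Qy; apply: le_trans h _; rewrite -gy//.
  exact: le_trans (le_euclid (g ^~ y) i) (Ly Oy).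
apply: (@le_lt_trans _ _ (Num.max M (c^-1 * L))%:E); last exact: ltry.
apply: ge_ereal_sup => _ [z Bz <-]; rewrite lee_fin le_max.
by case: (BOsub Bz) => [/hM ->//|/wfar ->]; rewrite orbT.
Qed.

(** The test fields have the single component [s * chi m] in the direction
    [i], where the cutoffs [chi m] increase to one on [Q `*` far]. *)
Lemma cond_A_of_NLBV : NLBV Omega w u -> cond_A Omega w 1 B.
Proof.
move=> [_ Nu]; apply: (cond_A_of_far ltr01).
have [chi [Cchi chi01 chi_nd chi1]] := exists_cutoffs oQfar.
have chi_out m z : ~ (Q `*` far) z -> chi m z = 0.
  move=> nz; apply: zero_off_support => cz; apply: nz.
  by case: (Cchi m) => _ [_]; exact.
have mchi m : measurable_fun setT (chi m).
  have [d _] := Ck_c1_setT (Cchi m).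
  by apply: (open_continuous_measurable_rV2 openT) => z _; exact: (differentiable_continuous (d z I)).
have mw : measurable_fun (Q `*` far) w.
  apply: (open_continuous_measurable_rV2 oQfar) => z /QfarO.
  exact: admissible_continuous.
have bound m : (\int[leb2]_(z in Q `*` far) (c * w z * chi m z)%:E <= NLTV Omega w u)%E.
  have := integral_nl_div oO hw hu (phi := fun j z => if j == i then s * chi m z else 0).
  have Cphi j : Ck_c 1 (Omega `*` Omega) (fun z => if j == i then s * chi m z else 0).
    case: eqP => _; last first.
      split; first exact: is_Ck_cst.
      by apply: (@supported_compact _ _ _ set0) => //; exact: compact0.
    have [_ [cs sU]] := Cchi m; split.
      apply: (is_Ck_subset (@subsetT _ _)); apply: is_CkM.
        exact: is_Ck_cst.
      exact: Ck_c1_setT (Cchi m).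
    apply: (supported_compact cs); first exact: subset_trans sU QfarO.
    by move=> z /zero_off_support ->; rewrite mulr0.
  move=> /(_ Cphi) E.
  have phi1 z : euclid (fun j : 'I_n => if j == i then s * chi m z else 0) <= 1.
    rewrite euclid_single normrM s1 mul1r.
    by have /andP[? ?] := chi01 m z; rewrite ger0_norm.
  apply: (@le_trans _ _ (\int[leb]_(x in Omega)
    (u x * nl_div Omega w (fun j z => if j == i then s * chi m z else 0) x)%:E)%E); last first.
    by apply: ereal_sup_ubound; exists (fun j z => if j == i then s * chi m z else 0).
  rewrite E (bigD1 i)//= big1 ?adde0; last first.
    move=> j /negPf ji; apply: integral0_eq => z _.
    by rewrite ji mulr0.
  rewrite eqxx.
  have [_ iG _] := integral_nl_partial_adj_Ck_c oO hw hu i (Cphi i).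
  rewrite eqxx in iG.
  have -> : (- (\int[leb2]_(z in Omega `*` Omega) (nl_grad w u i z * (s * chi m z))%:E) =
      \int[leb2]_(z in Q `*` far) (- s * nl_grad w u i z * chi m z)%:E)%E.
    rewrite -integralN; last first.
      by apply: integrable_add_def.
    rewrite [LHS]integral_mkcond [RHS]integral_mkcond; apply: eq_integral => z _.
    rewrite !patchE; have [Qz|nQz] := pselect ((Q `*` far) z).
      by rewrite !mem_set//; [congr EFin; ring|exact: QfarO].
    by rewrite (memNset nQz); case: ifPn => // _; rewrite chi_out// !mulr0 oppe0.
  have mG : measurable_fun (Q `*` far) (nl_grad w u i).
    apply: (open_continuous_measurable_rV2 oQfar) => z /QfarO.
    exact: (nl_grad_continuous hw Cu).
  apply: ge0_le_integral => //.
  - move=> z /QfarO Oz; rewrite lee_fin !mulr_ge0 ?(ltW c0) ?(admissible_ge0 hw)//.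
    by have /andP[] := chi01 m z.
  - apply/measurable_EFinP; apply: measurable_funM; last exact: measurable_funTS.
    exact: measurable_funM.
  - apply/measurable_EFinP; apply: measurable_funM; last exact: measurable_funTS.
    exact: measurable_funM.
  - move=> z Qz; rewrite lee_fin ler_wpM2r//; first by have /andP[] := chi01 m z.
    by have [] := weight_le_nl_grad Qz.
have lim : (\int[leb2]_(z in Q `*` far) (c * w z * chi m z)%:E @[m --> \oo] -->
    \int[leb2]_(z in Q `*` far) (c * w z)%:E)%E.
  have cw0 z : (Q `*` far) z -> 0 <= c * w z.
    by move=> /QfarO Oz; rewrite mulr_ge0 ?(ltW c0) ?(admissible_ge0 hw).
  have -> : (\int[leb2]_(z in Q `*` far) (c * w z)%:E =
      \int[leb2]_(z in Q `*` far) limn (fun m => (c * w z * chi m z)%:E))%E.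
    apply: eq_integral => z /set_mem Qz; apply/esym/cvg_lim => //.
    apply/fine_cvgP; split; first exact: nearW.
    rewrite -[X in _ --> X]mulr1; apply: cvgM; [exact: cvg_cst|exact: chi1].
  apply: cvg_monotone_convergence => //.
  - move=> m; apply/measurable_EFinP; apply: measurable_funM; last exact: measurable_funTS.
    exact: measurable_funM.
  - move=> m z Qz; rewrite lee_fin mulr_ge0 ?cw0//.
    by have /andP[] := chi01 m z.
  - by move=> z Qz p q pq; rewrite lee_fin ler_wpM2l ?cw0//; exact: chi_nd.
have le : (\int[leb2]_(z in Q `*` far) (c * w z)%:E <= NLTV Omega w u)%E.
  rewrite -(cvg_lim _ lim)//; apply: lime_le; first by apply/cvg_ex; eexists; exact: lim.
  exact: nearW.
have E : (\int[leb2]_(z in Q `*` far) (w z `^ 1)%:E =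
    (c^-1)%:E * \int[leb2]_(z in Q `*` far) (c * w z)%:E)%E.
  rewrite -ge0_integralZl_EFin ?invr_ge0 ?(ltW c0)//.
  - apply: eq_integral => z /set_mem /QfarO Oz.
    by rewrite powRr1 ?(admissible_ge0 hw)// -EFinM mulrA mulVf ?gt_eqF// mul1r.
  - move=> z /QfarO Oz.
    by rewrite lee_fin mulr_ge0 ?(ltW c0) ?(admissible_ge0 hw).
  - by apply/measurable_EFinP; exact: measurable_funM.
rewrite E lte_mul_pinfty ?lee_fin ?invr_ge0 ?(ltW c0)//.
exact: le_lt_trans le Nu.
Qed.

End localized.
End necessary_conditions.

(** * From local to global *)

Lemma Cinfty_c_Ck_c1 (R : realType) (W : normedModType R) (U : set W) (f : W -> R) :
  Cinfty_c U f -> Ck_c 1 U f.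
Proof. by case=> Cf sf; split => //; exact: (Cf 1%N). Qed.

Section test_functions.
Context {R : realType} {n : nat}.
Local Notation V := 'rV[R]_n.
Variable i : 'I_n.
Local Notation e_i := (delta_mx ord0 i : V).

(** On a line in the direction of a coordinate the function would be constant,
    and the line leaves the support. *)
Lemma exists_partial_neq0 (U : set V) (u : V -> R) : Ck_c 1 U u ->
  u <> (fun=> 0) -> exists2 x, U x & 'D_e_i u x != 0.
Proof.
move=> hu; apply: contra_notP => nex.
have [du _] := Ck_c1_setT hu; case: (hu) => _ [cS SU].
have D0 x : 'D_e_i u x = 0.
  have [Ux|nUx] := pselect (U x).
    by apply/eqP; apply: contrapT => /negP Dn0; apply: nex; exists x.
  apply: (derive_zero_off (@closed_closure _ _) (@zero_off_support _ _ u)).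
  by move=> /SU.
have [M M0 SM] := compact_sub_ball cS.
apply/funext => x; pose g (t : R) := u (t *: e_i + x).
have gD (t : R) : is_derive t (1 : R) g 0.
  have q : (fun h => h^-1 *: ((u \o shift (t *: e_i + x)) (h *: e_i) - u (t *: e_i + x))) =
      (fun h => h^-1 *: ((g \o shift t) (h *: 1) - g t)).
    by apply/funext => h /=; rewrite /g [h *: 1]mulr1 scalerDl addrA.
  have := @diff_derivable _ _ _ u (t *: e_i + x) e_i (du _ I).
  have := D0 (t *: e_i + x); rewrite /derive /derivable q => DE dv.
  by apply: DeriveDef.
have -> : u x = g 0 by rewrite /g scale0r add0r.
rewrite (is_derive_0_is_cst 0 (M + `|x ord0 i|) gD) /g.
apply: zero_off_support => /SM /rV_ballP[_ /(_ i)].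
rewrite !mxE !eqxx mulr1 sub0r normrN ltNge => /negP; apply.
apply: le_trans (ler_norm _); rewrite -addrA lerDl addrC -lerBlDr sub0r.
by rewrite lerNl -normrN ler_norm.
Qed.

Let ball_bump_shift (a : V) r x : ball_bump a r x = ball_bump 0 r (x - a).
Proof.
by rewrite /ball_bump; congr (_ * _); apply: eq_bigr => j _; congr (flat _ _ * flat _ _);
  rewrite !mxE; ring.
Qed.

(** Some bump has a nonzero partial derivative somewhere; translate that point
    to [x0]. The translated ball still lies within twice its radius of [x0],
    since the point was in the support. *)
Lemma exists_test_function (U : set V) x0 : open U -> U x0 ->
  exists2 u, Cinfty_c U u & 'D_e_i u x0 != 0.
Proof.
move=> oU Ux0.
have /nbhs_ballP[e/= e0 eU] : nbhs x0 U by exact: open_nbhs_nbhs.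
pose r := e / 3; have r0 : 0 < r by rewrite divr_gt0.
have Cb : Cinfty_c setT (ball_bump (0 : V) r) by exact: Cinfty_c_bump.
have [|z _ Dz] := exists_partial_neq0 (Cinfty_c_Ck_c1 Cb).
  move=> /(congr1 (fun f => f 0)) => b0.
  by have := ball_bump_gt0 (ballxx (0 : V) r0); rewrite b0 ltxx.
have zr : `|z| <= r.
  have [|nz] := pselect (closed_ball (0 : V) r z).
    by rewrite closed_ballE// /closed_ball_/= sub0r normrN.
  move: Dz; rewrite (derive_zero_off _ (@ball_bump_off_closed_ball R n 0 r)) ?eqxx//.
  exact: closed_ball_closed.
exists (ball_bump (x0 - z) r).
  apply: Cinfty_c_bump => y; rewrite closed_ballE// /closed_ball_/= => yr.
  apply: eU; rewrite -ball_normE/=.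
  rewrite (_ : x0 - y = (x0 - z - y) + z); last by rewrite (addrAC x0) subrK.
  apply: le_lt_trans (ler_normD _ _) _.
  apply: (@le_lt_trans _ _ (r + r)); first by apply: lerD.
  by rewrite /r; lra.
have q : (fun h => h^-1 *:
      ((ball_bump (x0 - z) r \o shift x0) (h *: e_i) - ball_bump (x0 - z) r x0)) =
    (fun h => h^-1 *: ((ball_bump 0 r \o shift z) (h *: e_i) - ball_bump 0 r z)).
  apply/funext => h /=; rewrite ![ball_bump (x0 - z) r _]ball_bump_shift.
  by rewrite -addrA !subKr.
by rewrite /derive q.
Qed.

End test_functions.

Section criterion.
Context {R : realType} {n : nat}.
Local Notation V := 'rV[R]_n.
Variables (i : 'I_n) (Omega : set V) (oO : open Omega).
Variables (X : set (V -> R)) (A : set V -> Prop).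
Hypothesis A_sufficient : forall u K, Cinfty_c Omega u -> compact K -> K `<=` Omega ->
  closure [set x | u x != 0] `<=` K -> A K -> X u.
Hypothesis A_necessary : forall u x, Cinfty_c Omega u -> X u -> Omega x ->
  'D_(delta_mx ord0 i : V) u x != 0 ->
  exists r, [/\ 0 < r, closed_ball x r `<=` Omega & A (closed_ball x r)].
Hypothesis A0 : A set0.
Hypothesis AU : forall K L, compact K -> compact L -> K `<=` Omega -> L `<=` Omega ->
  A K -> A L -> A (K `|` L).
Hypothesis A_subset : forall K L, compact K -> compact L -> L `<=` Omega ->
  K `<=` L -> A L -> A K.

(** Finitely many of the balls cover [K]. *)
Lemma compact_of_local (K : set V) : compact K -> K `<=` Omega ->
  (forall x, K x -> exists r, [/\ 0 < r, closed_ball x r `<=` Omega & A (closed_ball x r)]) ->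
  A K.
Proof.
move=> cK KO loc.
have h x : exists r, K x -> [/\ 0 < r, closed_ball x r `<=` Omega & A (closed_ball x r)].
  by have [/loc[r hr]|nK] := pselect (K x); [exists r|exists 0].
have [r hr] := choice h.
have : cover_compact K by rewrite -compact_cover.
move=> /(_ V K (fun x => ball x (r x))) [||D DK KD].
- by move=> x _; exact: ball_open.
- by move=> x Kx; exists x => //; apply: ballxx; have [] := hr x Kx.
pose L (s : seq V) := \big[setU/set0]_(x <- s) closed_ball x (r x).
have hL (s : seq V) : {in s, forall x, K x} -> [/\ compact (L s), L s `<=` Omega & A (L s)].
  elim: s => [|x s IHs] sK; rewrite /L ?big_nil ?big_cons; first by split => //; exact: compact0.
  have [|cs sO As] := IHs; first by move=> y ys; apply: sK; rewrite inE ys orbT.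
  have [_ xO Ax] : [/\ 0 < r x, closed_ball x (r x) `<=` Omega & A (closed_ball x (r x))].
    by apply: hr; apply: sK; rewrite mem_head.
  split; first by apply: compactU => //; exact: compact_closed_ball.
    by move=> y [/xO|/sO].
  by apply: AU => //; exact: compact_closed_ball.
have [|cD DO AD] := hL (finmap.enum_fset D).
  by move=> x /DK; rewrite inE.
apply: (A_subset cK cD DO _ AD) => x /KD[y /= yD xy].
rewrite /L -bigcup_seq; exists y => //=; exact: subset_closed_ball.
Qed.

(** The zero function always belongs to the intersection, so that being
    different from its singleton means to contain a nonzero function. *)
Lemma nontrivial_iff : X `&` Cinfty_c Omega <> [set (fun=> 0)] <->
  exists K, [/\ compact K, K `<=` Omega, interior K !=set0 & A K].
Proof.
split=> [|[K [cK KO [a Ka] AK]] X0].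
  apply: contra_notP => nex; apply/seteqP; split => [u [Xu Cu]|_ ->].
    apply: contrapT => un0; apply: nex.
    have [x Ox Dx] := exists_partial_neq0 i (Cinfty_c_Ck_c1 Cu) un0.
    have [r [r0 rO Ar]] := A_necessary Cu Xu Ox Dx.
    exists (closed_ball x r); split => //; first exact: compact_closed_ball.
    by exists x; apply: filterS (nbhsx_ballx x r r0); exact: subset_closed_ball.
  have supp0 : closure [set x : V | (0 : R) != 0] `<=` set0.
    rewrite (_ : [set x | _] = set0) ?closure0//.
    by rewrite -subset0 => x /=; rewrite eqxx.
  have C0 : Cinfty_c Omega (fun _ : V => 0 : R).
    split; first by move=> k; exact: is_Ck_cst.
    by apply: (@supported_compact _ _ _ set0) => //; exact: compact0.
  by split => //; apply: (A_sufficient C0 (@compact0 _)).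
have /nbhs_ballP[e/= e0 eK] := Ka.
have e2 : 0 < e / 2 by rewrite divr_gt0.
have beK : closed_ball a (e / 2) `<=` K.
  apply: subset_trans eK; apply: closed_ball_sub_ball.
  by rewrite ltr_pdivrMr// ltr_pMr// ltr1n.
have Cb : Cinfty_c Omega (ball_bump a (e / 2)).
  by apply: Cinfty_c_bump; exact: subset_trans beK KO.
have : (X `&` Cinfty_c Omega) (ball_bump a (e / 2)).
  split => //; apply: (A_sufficient Cb cK KO _ AK).
  apply: subset_trans beK.
  rewrite (closure_id (closed_ball a (e / 2))).1; last exact: closed_ball_closed.
  apply: closure_subset => x /= bx; apply: contrapT => /ball_bump_off_closed_ball b0.
  by rewrite b0 eqxx in bx.
rewrite X0 => /(congr1 (fun f => f a)) b0.
by have := ball_bump_gt0 (ballxx a e2); rewrite b0 ltxx.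
Qed.

Lemma inclusion_iff : Cinfty_c Omega `<=` X <->
  forall K, compact K -> K `<=` Omega -> A K.
Proof.
split=> [CX K cK KO|AK u Cu]; last first.
  have [_ [cS SO]] := Cu; exact: (A_sufficient Cu cS SO _ (AK _ cS SO)).
apply: (compact_of_local cK KO) => x /KO Ox.
have [u Cu Du] := exists_test_function i oO Ox.
exact: (A_necessary Cu (CX _ Cu) Ox Du).
Qed.

End criterion.

Section conditions.
Context {R : realType} {n : nat}.
Local Notation V := 'rV[R]_n.
Local Notation leb2 := (@lebesgue_rV R n \x @lebesgue_rV R n)%E.
Variables (Omega : set V) (w : V * V -> R).
Hypotheses (oO : open Omega) (hw : admissible Omega w).

Let mO : measurable Omega. Proof. exact: open_measurable_rV. Qed.

Let mwp p A : measurable A -> A `<=` Omega `*` Omega ->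
  measurable_fun A (fun z => (w z `^ p)%:E).
Proof.
move=> mA AO; apply/measurable_EFinP.
apply: measurable_funS (measurable_admissible_powR oO hw p) => //.
by apply: open_measurable_rV2; exact: open_setX.
Qed.

Lemma cond_A_set0 p : cond_A Omega w p set0.
Proof. by rewrite /cond_A integral_set0 ltry. Qed.

Lemma cond_A_subset p K L : compact K -> compact L -> L `<=` Omega -> K `<=` L ->
  cond_A Omega w p L -> cond_A Omega w p K.
Proof.
move=> /compact_measurable_rV mK /compact_measurable_rV mL LO KL.
move=> /(cond_AE oO hw _ mL LO) AL.
apply/(cond_AE oO hw _ mK (subset_trans KL LO)); apply: le_lt_trans AL.
apply: ge0_subset_integral; [exact: measurableX|exact: measurableX| | |].
- by apply: mwp; [exact: measurableX|move=> z [/LO z1 z2]].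
- by move=> z _; rewrite lee_fin powR_ge0.
- by move=> z [/KL z1 z2].
Qed.

Lemma cond_A_setU p K L : compact K -> compact L -> K `<=` Omega -> L `<=` Omega ->
  cond_A Omega w p K -> cond_A Omega w p L -> cond_A Omega w p (K `|` L).
Proof.
move=> /compact_measurable_rV mK /compact_measurable_rV mL KO LO.
move=> /(cond_AE oO hw _ mK KO) AK /(cond_AE oO hw _ mL LO) AL.
have KLO : K `|` L `<=` Omega by move=> x [/KO|/LO].
apply/(cond_AE oO hw _ (measurableU _ _ mK mL) KLO).
have wp0 z : (0 <= (w z `^ p)%:E)%E by rewrite lee_fin powR_ge0.
have mLK : measurable (L `\` K) by exact: measurableD.
have E : (K `|` L) `*` Omega = (K `*` Omega) `|` ((L `\` K) `*` Omega).
  apply/seteqP; split => z.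
    move=> [[Kz|Lz] Oz]; first by left.
    by have [Kz|nKz] := pselect (K z.1); [left|right].
  by move=> [[Kz Oz]|[[Lz _] Oz]]; split => //; [left|right].
rewrite E ge0_integral_setU//.
- rewrite lte_add_pinfty//; apply: le_lt_trans AL.
  apply: ge0_subset_integral => //; [exact: measurableX|exact: measurableX| |].
    by apply: mwp; [exact: measurableX|move=> z [/LO z1 z2]].
  by move=> z [[z1 _] z2].
- exact: measurableX.
- exact: measurableX.
- rewrite -E; apply: mwp; first by apply: measurableX => //; exact: measurableU.
  by move=> z [/KLO z1 z2].
- by apply/disj_setPLR => z [Kz _] [[_ nKz] _].
Qed.

Lemma cond_Aoo_set0 : cond_Aoo Omega w set0.
Proof. by rewrite /cond_Aoo set0X image_set0 ereal_sup0. Qed.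

Lemma cond_Aoo_subset K L : K `<=` L -> cond_Aoo Omega w L -> cond_Aoo Omega w K.
Proof.
move=> KL; apply: le_lt_trans; apply: ereal_sup_le => _ [z [/KL z1 z2] <-].
by exists z.
Qed.

Lemma cond_Aoo_setU K L : cond_Aoo Omega w K -> cond_Aoo Omega w L ->
  cond_Aoo Omega w (K `|` L).
Proof.
rewrite /cond_Aoo => AK AL; set a := ereal_sup _ in AK; set b := ereal_sup _ in AL.
apply: (@le_lt_trans _ _ (maxe a b)); last by rewrite gt_max AK.
apply: ge_ereal_sup => _ [z [[Kz|Lz] Oz] <-]; rewrite le_max.
  by rewrite ereal_sup_ubound//; exists z.
by rewrite [X in _ || X]ereal_sup_ubound ?orbT//; exists z.
Qed.

End conditions.

(** * Test functions in nonlocal Sobolev spaces *)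

Theorem theorem1p4 (R : realType) (N : nat) (hN : (0 < N)%N)
    (Omega : set 'rV[R]_N) (Omega_open : open Omega) (Omega_neq0 : Omega !=set0)
    (p : R) (hp : 1 <= p)
    (w : 'rV[R]_N * 'rV[R]_N -> R) (hw : admissible Omega w) :
  [/\ W1 Omega w p%:E `&` Cinfty_c Omega <> [set (fun=> 0)] <->
        (exists K, [/\ compact K, K `<=` Omega, interior K !=set0 &
                       cond_A Omega w p K]),
      W1 Omega w +oo%E `&` Cinfty_c Omega <> [set (fun=> 0)] <->
        (exists K, [/\ compact K, K `<=` Omega, interior K !=set0 &
                       cond_Aoo Omega w K]),
      Cinfty_c Omega `<=` W1 Omega w p%:E <->
        (forall K, compact K -> K `<=` Omega -> cond_A Omega w p K),
      Cinfty_c Omega `<=` W1 Omega w +oo%E <->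
        (forall K, compact K -> K `<=` Omega -> cond_Aoo Omega w K) &
      p = 1 ->
        (NLBV Omega w `&` Cinfty_c Omega <> [set (fun=> 0)] <->
          (exists K, [/\ compact K, K `<=` Omega, interior K !=set0 &
                         cond_A Omega w p K])) /\
        (Cinfty_c Omega `<=` NLBV Omega w <->
          (forall K, compact K -> K `<=` Omega -> cond_A Omega w p K))].
Proof.
have p0 : 0 < p by exact: lt_le_trans hp.
pose i : 'I_N := Ordinal hN.
have AU q := @cond_A_setU R N Omega w Omega_open hw q.
have AS q := @cond_A_subset R N Omega w Omega_open hw q.
have AooS K L : compact K -> compact L -> L `<=` Omega -> K `<=` L ->
    cond_Aoo Omega w L -> cond_Aoo Omega w K.
  by move=> _ _ _; exact: cond_Aoo_subset.
have AooU K L : compact K -> compact L -> K `<=` Omega -> L `<=` Omega ->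
    cond_Aoo Omega w K -> cond_Aoo Omega w L -> cond_Aoo Omega w (K `|` L).
  by move=> _ _ _ _; exact: cond_Aoo_setU.
have Wsuff u K : Cinfty_c Omega u -> compact K -> K `<=` Omega ->
    closure [set x | u x != 0] `<=` K -> cond_A Omega w p K -> W1 Omega w p%:E u.
  move=> /Cinfty_c_Ck_c1 Cu cK KO Ku.
  exact: (W1_of_cond_A Omega_open hw Cu cK KO Ku p0).
have Woosuff u K : Cinfty_c Omega u -> compact K -> K `<=` Omega ->
    closure [set x | u x != 0] `<=` K -> cond_Aoo Omega w K -> W1 Omega w +oo%E u.
  move=> /Cinfty_c_Ck_c1 Cu cK KO Ku.
  exact: (W1_of_cond_Aoo Omega_open hw Cu cK KO Ku).
have BVsuff u K : Cinfty_c Omega u -> compact K -> K `<=` Omega ->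
    closure [set x | u x != 0] `<=` K -> cond_A Omega w 1 K -> NLBV Omega w u.
  move=> /Cinfty_c_Ck_c1 Cu cK KO Ku.
  exact: (NLBV_of_cond_A Omega_open hw Cu cK KO Ku).
(* The necessity lemmas assume a lower bound on a derivative over a ball, which
   a nonzero derivative at the centre provides. *)
have nec (X : set ('rV[R]_N -> R)) (A : set 'rV[R]_N -> Prop) :
    (forall u x (r s c : R), Ck_c 1 Omega u -> X u -> 0 < r -> `|s| = 1 -> 0 < c ->
      ball x (r *+ 2) `<=` Omega ->
      (forall y, ball x (r *+ 2) y -> c <= s * 'D_(delta_mx ord0 i) u y) ->
      A (closed_ball x r)) ->
    forall u x, Cinfty_c Omega u -> X u -> Omega x ->
    'D_(delta_mx ord0 i : 'rV[R]_N) u x != 0 ->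
    exists r, [/\ 0 < r, closed_ball x r `<=` Omega & A (closed_ball x r)].
  move=> XA u x /Cinfty_c_Ck_c1 Cu Xu Ox Dx.
  have [r [s [c [r0 s1 c0 rO rc]]]] := derivative_away_from0 Omega_open Cu Ox Dx.
  exists r; split => //; last exact: (XA u x r s c).
  apply: subset_trans rO; apply: closed_ball_sub_ball.
  by rewrite mulr2n ltrDl.
have Wnec : _ := nec (W1 Omega w p%:E) (cond_A Omega w p)
  (fun u x r s c Cu Xu r0 s1 c0 rO rc =>
     cond_A_of_W1 Omega_open hw Cu r0 s1 c0 rO rc p0 Xu).
have Woonec : _ := nec (W1 Omega w +oo%E) (cond_Aoo Omega w)
  (fun u x r s c Cu Xu r0 s1 c0 rO rc =>
     cond_Aoo_of_W1 Omega_open hw Cu r0 s1 c0 rO rc Xu).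
have BVnec : _ := nec (NLBV Omega w) (cond_A Omega w 1)
  (fun u x r s c Cu Xu r0 s1 c0 rO rc =>
     cond_A_of_NLBV Omega_open hw Cu r0 s1 c0 rO rc Xu).
split.
- exact: (nontrivial_iff Wsuff Wnec (cond_A_set0 _ _ _)).
- exact: (nontrivial_iff Woosuff Woonec (cond_Aoo_set0 _ _)).
- exact: (inclusion_iff Omega_open Wsuff Wnec (cond_A_set0 _ _ _) (AU p) (AS p)).
- exact: (inclusion_iff Omega_open Woosuff Woonec (cond_Aoo_set0 _ _) AooU AooS).
- move=> ->; split.
    exact: (nontrivial_iff BVsuff BVnec (cond_A_set0 _ _ _)).
  exact: (inclusion_iff Omega_open BVsuff BVnec (cond_A_set0 _ _ _) (AU 1) (AS 1)).
Qed.
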